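(* Let $d\ge 2$. Let $\mathcal{D}_n^A$ be the Weyl random cone of type $A_{n-1}$ built from random vectors in $\mathbb{R}^d$ that are almost surely in type $A$ general position, and let $\mathcal{D}_n^B$ be the Weyl random cone of type $B_n$ built from random vectors in $\mathbb{R}^d$ that are almost surely in type $B$ general position. The expected conic quermassintegrals are $$\mathbb{E}\,U_j(\mathcal{D}_n^A)=\frac{D^A(n,d-j)}{2D^A(n,d)},\qquad \mathbb{E}\,U_j(\mathcal{D}_n^B)=\frac{D^B(n,d-j)}{2D^B(n,d)},\qquad j=0,\ldots,d-1.$$
   Context: Type $A$ general position: $y_1,\ldots,y_n\in\mathbb{R}^d$ with $n\ge d+1$ such that for every permutation $\sigma$ of $\{1,\ldots,n\}$ any $d$ of the vectors $y_{\sigma(1)}-y_{\sigma(2)},\ldots,y_{\sigma(n-1)}-y_{\sigma(n)}$ are linearly independent. Type $B$ general position: $y_1,\ldots,y_n\in\mathbb{R}^d$ with $n\ge d$ such that for every $\varepsilon\in\{\pm1\}^n$ and every permutation $\sigma$ of $\{1,\ldots,n\}$ any $d$ of the vectors $\varepsilon_1y_{\sigma(1)}-\varepsilon_2y_{\sigma(2)},\ldots,\varepsilon_{n-1}y_{\sigma(n-1)}-\varepsilon_ny_{\sigma(n)},\,\varepsilon_ny_{\sigma(n)}$ are linearly independent. For $x\in\mathbb{R}^d\setminus\{0\}$ let $x^\perp=\{v\in\mathbb{R}^d:\langle v,x\rangle=0\}$. The Weyl tessellation $\mathcal{W}^A(y_1,\ldots,y_n)$ (resp. $\mathcal{W}^B(y_1,\ldots,y_n)$)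 is the set of cones obtained as closures of the connected components of the complement in $\mathbb{R}^d$ of the union of the hyperplanes $(y_i-y_j)^\perp$, $1\le i<j\le n$ (resp. of the hyperplanes $(y_i+y_j)^\perp$, $(y_i-y_j)^\perp$, $1\le i<j\le n$, and $y_i^\perp$, $1\le i\le n$). Given (possibly dependent) random vectors $Y_1,\ldots,Y_n$ in $\mathbb{R}^d$ a.s. in type $A$ (resp. type $B$) general position, the Weyl random cone $\mathcal{D}_n^A$ (resp. $\mathcal{D}_n^B$) is obtained by choosing uniformly at random one of the cones of $\mathcal{W}=\mathcal{W}^A(Y_1,\ldots,Y_n)$ (resp. $\mathcal{W}=\mathcal{W}^B(Y_1,\ldots,Y_n)$); that is, for a functional $\varphi$ of cones its expectation at the random cone is $\mathbb{E}\big[\frac{1}{\#\mathcal{W}}\sum_{C\in\mathcal{W}}\varphi(C)\big]$. For a cone $C\subseteq\mathbb{R}^d$ that is not a linear subspace (the only case that occurs here), $U_j(C)=\frac12\int_{G(d,d-j)}\mathbf{1}\{C\cap L\ne\{0\}\}\,\nu_{d-j}(\mathrm{d}L)$ for $j=0,\ldots,d$, where $G(d,m)$ is the Grassmannian of $m$-dimensional linear subspaces of $\mathbb{R}^d$ and $\nu_m$ its unique rotation-invariant Borel probability measure. $\genfrac{[}{]}{0pt}{}{n}{k}$ and $B[n,k]$ are defined by $t(t+1)\cdots(t+n-1)=\sum_{k=1}^n\genfrac{[}{]}{0pt}{}{n}{k}t^k$ and $(t+1)(t+3)\cdots(t+2n-1)=\sum_{k=0}^nB[n,k]t^k$, and are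 zero for $k$ outside $\{1,\ldots,n\}$, resp. $\{0,\ldots,n\}$. Put $D^A(m,k):=2\sum_{i\ge0}\genfrac{[}{]}{0pt}{}{m}{m-k+1+2i}$ and $D^B(m,k):=2\sum_{i\ge0}B[m,m-k+1+2i]$. *)

(* Defs.v *)
From HB Require Import structures.
From mathcomp Require Import all_boot all_order all_algebra all_fingroup.
From mathcomp Require Import finmap.
From mathcomp Require Import all_classical all_reals all_analysis.
Import Order.TTheory GRing.Theory Num.Theory.
Import numFieldNormedType.Exports.

Set Implicit Arguments.
Unset Strict Implicit.
Unset Printing Implicit Defensive.

Local Open Scope classical_set_scope.
Local Open Scope ring_scope.

Definition borel (T : ptopologicalType) := g_sigma_algebraType (@open T).

HB.instance Definition _ (T : ptopologicalType) :=
  Measurable.on (borel T).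

Section GeneralPosition.
Variables (R : realType) (d n : nat).
Implicit Types (y : 'I_n -> 'rV[R]_d) (s : seq 'rV[R]_d).

(* (z_1 - z_2, ..., z_(m-1) - z_m) for s = (z_1, ..., z_m) *)
Definition consecutive_diffs s : seq 'rV[R]_d :=
  [seq p.1 - p.2 | p <- zip s (behead s)].

(* A subsequence of size d is a choice of d distinct positions, so repeated
   values count as dependent. *)
Definition any_free (k : nat) s : Prop :=
  forall t : seq 'rV[R]_d, subseq t s -> size t = k -> free t.

Definition general_positionA y : Prop :=
  (d.+1 <= n)%N /\
  forall sigma : 'S_n,
    any_free d (consecutive_diffs [seq y (sigma i) | i <- enum 'I_n]).

(* The sign eps_i is (-1) ^+ e i. *)
Definition general_positionB y : Prop :=
  (d <= n)%N /\
  forall (e : 'I_n -> bool) (sigma : 'S_n),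
    let z := [seq (-1) ^+ e i *: y (sigma i) | i <- enum 'I_n] in
    any_free d (rcons (consecutive_diffs z) (last 0 z)).

End GeneralPosition.

Section Tessellation.
Variables (R : realType) (d : nat).

Definition perp (x : 'rV[R]_d) : set 'rV[R]_d :=
  [set v : 'rV[R]_d | \sum_(k < d) v 0 k * x 0 k = 0].

Definition tessellation (N : set 'rV[R]_d) : set (set 'rV[R]_d) :=
  let U := ~` \bigcup_(x in N) perp x in
  [set closure (connected_component U v) | v in U].

Variable n : nat.
Implicit Type y : 'I_n -> 'rV[R]_d.

Definition weylA y : set (set 'rV[R]_d) :=
  tessellation [set y p.1 - y p.2 | p in [set p : 'I_n * 'I_n | (p.1 < p.2)%N]].

Definition weylB y : set (set 'rV[R]_d) :=
  tessellation
    ([set y p.1 + y p.2 | p in [set p : 'I_n * 'I_n | (p.1 < p.2)%N]]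
     `|` [set y p.1 - y p.2 | p in [set p : 'I_n * 'I_n | (p.1 < p.2)%N]]
     `|` range y).

End Tessellation.

(* Expected value of phi at a cone drawn uniformly at random from W. *)
Definition random_cone_mean (R : realType) (d : nat) (disp : measure_display)
    (Omega : measurableType disp) (P : probability Omega R)
    (W : Omega -> set (set 'rV[R]_d)) (phi : set 'rV[R]_d -> R) : \bar R :=
  'E_P[fun w => (#|` fset_set (W w)|%:R)^-1 * \sum_(C \in W w) phi C].

(* [m <= d] is carried by the type because a measurable space has to be
   inhabited. *)
Definition grass (R : realType) (d m : nat) (le_md : (m <= d)%N) : Type :=
  {L : {vspace 'rV[R]_d} | \dim L == m}.
Arguments grass : clear implicits.
Arguments grass R {d m} le_md.

Section Grassmannian.
Variables (R : realType) (d m : nat) (le_md : (m <= d)%N).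

Local Notation G := (grass R le_md).

HB.instance Definition _ := Choice.on G.

(* As a type, [frames] carries the topology induced from 'M[R]_(m, d). *)
Definition frames : set 'M[R]_(m, d) := [set A | row_free A].

Definition row_space (A : 'M[R]_(m, d)) : {vspace 'rV[R]_d} :=
  limg (linfun (mulmxr A : 'rV[R]_m -> 'rV[R]_d)).

Lemma dim_row_space (A : frames) : \dim (row_space (val A)) == m.
Proof.
have Af : row_free (val A) by have := valP A; rewrite inE.
rewrite /row_space limg_dim_eq ?dimvf /dim /= ?mul1n//.
apply/eqP; rewrite -subv0; apply/subvP => u; rewrite memv_cap memvf /= memv_ker.
by rewrite lfunE /= => /eqP uA; rewrite memv0 -(inj_eq (row_free_inj Af)) uA mul0mx.
Qed.

Definition span_frame (A : frames) : G :=
  exist (fun L : {vspace 'rV[R]_d} => \dim L == m) _ (dim_row_space A).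

Lemma pid_frame : (pid_mx m : 'M[R]_(m, d)) \in frames.
Proof. by apply/mem_set; rewrite /frames /= /row_free rank_pid_mx. Qed.

HB.instance Definition _ :=
  isPointed.Build G (span_frame (exist (fun A => A \in frames) _ pid_frame)).

(* The quotient topology for [span_frame]: the usual topology of G(d, m),
   viewed as the quotient of the noncompact Stiefel manifold by GL_m. *)
Definition grass_open (U : set G) : Prop := open (span_frame @^-1` U).

Let grass_openT : grass_open setT.
Proof. by rewrite /grass_open preimage_setT; exact: openT. Qed.

Let grass_openI : setI_closed grass_open.
Proof. by move=> U V oU oV; exact: openI. Qed.

Let grass_open_bigU (I : Type) (f : I -> set G) :
  (forall i, grass_open (f i)) -> grass_open (\bigcup_i f i).
Proof.
by move=> fo; rewrite /grass_open preimage_bigcup; apply: bigcup_open => i _;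
exact: fo.
Qed.

HB.instance Definition _ :=
  isOpenTopological.Build G grass_openT grass_openI grass_open_bigU.

(* {L g : L in B}; vectors are rows, so that g acts on the right. *)
Definition rotate_set (g : 'M[R]_d) (B : set G) : set G :=
  [set L | exists2 K : G, B K &
    val L = (linfun (mulmxr g : 'rV[R]_d -> 'rV[R]_d) @: val K)%VS].

Definition rotation_invariant (nu : set (borel G) -> \bar R) : Prop :=
  forall g : 'M[R]_d, g *m g^T = 1%:M -> \det g = 1 ->
  forall B : set (borel G), measurable B -> nu (rotate_set g B) = nu B.

End Grassmannian.

(* The value is U_j (C) when C is not a linear subspace and nu is the rotation
   invariant probability measure on G(d, d - j). *)
Definition quermass (R : realType) (d j : nat)
    (nu : probability (borel (grass R (leq_subr j d))) R)
    (C : set 'rV[R]_d) : R :=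
  2^-1 * \int[nu]_L
    \1_[set K : grass R (leq_subr j d) |
          C `&` [set v | v \in val K] <> [set 0]] L.

Definition stirlingA (n k : nat) : nat :=
  ((\prod_(i < n) ('X + i%:R%:P) : {poly nat})`_k)%R.

Definition stirlingB (n k : nat) : nat :=
  ((\prod_(i < n) ('X + (2 * i + 1)%N%:R%:P) : {poly nat})`_k)%R.

(* The index m - k + 1 + 2i is nonnegative under the side condition, and
   exceeds m as soon as i >= k. *)
Definition DA (m k : nat) : nat :=
  2 * \sum_(i < k | (k <= m + 1 + 2 * i)%N) stirlingA m (m + 1 + 2 * i - k).

Definition DB (m k : nat) : nat :=
  2 * \sum_(i < k | (k <= m + 1 + 2 * i)%N) stirlingB m (m + 1 + 2 * i - k).

(* Main.v *)
Require Import Defs.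
From mathcomp Require Import all_boot all_order all_algebra all_fingroup.
From mathcomp Require Import finmap.
From mathcomp Require Import all_classical all_reals all_analysis.
From mathcomp Require Import measurable_realfun.
From mathcomp Require Import ring lra zify.
Import Order.TTheory GRing.Theory Num.Theory.
Import numFieldNormedType.Exports.
Import HBNNSimple.

(** Both formulas come from counting the cells of hyperplane arrangements.

    Fix points [y] in general position, and call cells the open cones that their
    hyperplanes cut out; the tessellation consists of the closures of the cells.
    The sum of the quermassintegrals [U_j] over the tessellation is half the
    integral, over the subspaces [L] of dimension [d - j], of the number of closed
    cones that meet [L] outside the origin. For almost every [L] this integrand
    is a constant, namely the number of cells of the same kind of arrangement
    in dimension [d - j]; dividing by the number of cones, which is the same
    constant in dimension [d], gives the mean.

    The constant. For a hyperplane arrangement traced on a subspace [V], adding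
    one hyperplane cuts in two the cells that it meets, and they correspond to
    the cells of the trace on that hyperplane ([card_cells]). When the points
    are added one at a time, the [c_n] hyperplanes of the new point meet, pairwise,
    inside hyperplanes of the old points, so that each trace is an arrangement
    of the old points in one dimension less. Hence the number of cells satisfies
    [N(n + 1, m) = N(n, m) + c_n N(n, m - 1)], with [c_n = n] in type A and
    [c_n = 2 n + 1] in type B ([count_cells_weyl]). Twice the sum of every second
    coefficient of [(t + c_0) ... (t + c_(n-1))] satisfies the same recursion
    ([weyl_numberS]). The argument applies in every [V] in which the flats of the
    arrangement have the expected dimension. In the whole space this is
    general position ([generic_flats_full]); in a random [L] it is
    transversality to finitely many subspaces.

    Transversality. A rotation invariant probability on the Grassmannian gives
    mass 0 to the subspaces [L] that meet a given [X] outside the origin when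
    [dim X + dim L <= d] ([meets_null]): [X] has infinitely many rotated copies,
    which are all met with the same probability, while a given [L] meets only a
    bounded number of them, apart from a null set treated by induction on
    [dim X].

    Open and closed cells. If [L] is transversal to all the flats, then a point of
    [L] on the boundary of a cell can be moved inside [L] into the cell
    ([transversal_realizable]), so that meeting the closed cone outside the
    origin and meeting the open cell are the same condition ([ae_closed_cell]). *)

Set Implicit Arguments.
Unset Strict Implicit.
Unset Printing Implicit Defensive.

Local Open Scope classical_set_scope.
Local Open Scope ring_scope.

(** * Orthogonality and hyperplanes *)

Section Orthogonality.
Variables (R : realFieldType) (d : nat).
Implicit Types (u v h x : 'rV[R]_d) (V X : {vspace 'rV[R]_d}).
Implicit Types (s T : seq 'rV[R]_d).

Definition dot u v : R := \sum_(k < d) u 0 k * v 0 k.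

Lemma dotC u v : dot u v = dot v u.
Proof. by apply: eq_bigr => k _; rewrite mulrC. Qed.

Lemma dotDl u v h : dot (u + v) h = dot u h + dot v h.
Proof. by rewrite -big_split; apply: eq_bigr => k _; rewrite mxE mulrDl. Qed.

Lemma dotZl a u h : dot (a *: u) h = a * dot u h.
Proof. by rewrite mulr_sumr; apply: eq_bigr => k _; rewrite mxE mulrA. Qed.

Lemma dotNl u h : dot (- u) h = - dot u h.
Proof. by rewrite -scaleN1r dotZl mulN1r. Qed.

Lemma dotBl u v h : dot (u - v) h = dot u h - dot v h.
Proof. by rewrite dotDl dotNl. Qed.

Lemma dot0l h : dot 0 h = 0.
Proof. by rewrite -(scale0r 0) dotZl mul0r. Qed.

Lemma dotDr u v h : dot h (u + v) = dot h u + dot h v.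
Proof. by rewrite !(dotC h) dotDl. Qed.

Lemma dotZr a u h : dot h (a *: u) = a * dot h u.
Proof. by rewrite !(dotC h) dotZl. Qed.

Lemma dotNr u h : dot h (- u) = - dot h u.
Proof. by rewrite !(dotC h) dotNl. Qed.

Lemma dotBr u v h : dot h (u - v) = dot h u - dot h v.
Proof. by rewrite !(dotC h) dotBl. Qed.

Lemma dot0r h : dot h 0 = 0.
Proof. by rewrite dotC dot0l. Qed.

Lemma dot_ge0 v : 0 <= dot v v.
Proof. by apply: sumr_ge0 => k _; rewrite -expr2 sqr_ge0. Qed.

Lemma dot_eq0 v : (dot v v == 0) = (v == 0).
Proof.
apply/idP/eqP => [|->]; last by rewrite dot0l.
rewrite psumr_eq0 => [/allP v0|k _]; last by rewrite -expr2 sqr_ge0.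
apply/rowP => k; have := v0 k (mem_index_enum k).
by rewrite /= mulf_eq0 orbb mxE => /eqP.
Qed.

Lemma dot_mulmx u v : u *m v^T = (dot u v)%:M.
Proof.
apply/matrixP => i j; rewrite !ord1 !mxE mulr1n.
by apply: eq_bigr => k _; rewrite mxE.
Qed.

Definition hyper h : {vspace 'rV[R]_d} :=
  lker (linfun (mulmxr h^T : 'rV[R]_d -> 'rV[R]_1)).

Lemma memv_hyper h v : (v \in hyper h) = (dot v h == 0).
Proof.
rewrite memv_ker lfunE /= dot_mulmx; apply/eqP/eqP => [/matrixP/(_ 0 0)|->].
  by rewrite !mxE mulr1n.
by rewrite -scalemx1 scale0r.
Qed.

Lemma not_sub_hyper V h : ~~ (V <= hyper h)%VS -> exists2 w, w \in V & dot w h != 0.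
Proof. by case/subvPn => w wV; rewrite memv_hyper; exists w. Qed.

Definition orth_compl T : {vspace 'rV[R]_d} := (\bigcap_(h <- T) hyper h)%VS.

Lemma memv_orth_compl T v : (v \in orth_compl T) = all (fun h => dot v h == 0) T.
Proof.
rewrite /orth_compl; elim: T => [|h T IH]; first by rewrite big_nil memvf.
by rewrite big_cons memv_cap memv_hyper IH.
Qed.

Lemma orth_complP T v : reflect (forall h, h \in T -> dot v h = 0) (v \in orth_compl T).
Proof.
by rewrite memv_orth_compl; apply: (iffP allP) => H h hT; apply/eqP; [apply: H|rewrite H].
Qed.

Lemma orth_compl_cons h T : orth_compl (h :: T) = (hyper h :&: orth_compl T)%VS.
Proof. by rewrite /orth_compl big_cons. Qed.

Lemma orth_compl_nil : orth_compl [::] = fullv.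
Proof. by rewrite /orth_compl big_nil. Qed.

(** Orthogonal projection; Gram-Schmidt runs as an induction on the dimension
    of [X], which splits as the line of a vector [u] and the part of [X]
    orthogonal to [u]. *)
Lemma orth_decomp X v : exists2 a, a \in X & forall x, x \in X -> dot (v - a) x = 0.
Proof.
have [n] := ubnP (\dim X); elim: n X => // n IH X ltXn.
have [->|X0] := eqVneq X 0%VS.
  by exists 0; rewrite ?mem0v // => x; rewrite memv0 => /eqP ->; rewrite dot0r.
pose u := vpick X; have u0 : u != 0 by rewrite vpick0.
have uX : u \in X := memv_pick X.
have uu0 : dot u u != 0 by rewrite dot_eq0.
have lt' : (\dim (X :&: hyper u) < n)%N.
  apply: (@leq_trans (\dim X)); last by rewrite -ltnS.
  rewrite ltnNge; apply/negP => le_dim.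
  have /eqP eX : (X :&: hyper u == X)%VS by rewrite eqEdim capvSl.
  by move: uX; rewrite -eX memv_cap memv_hyper (negPf uu0) andbF.
have [a' ] := IH _ lt'; rewrite memv_cap memv_hyper => /andP[a'X /eqP a'u] Ha'.
exists (a' + (dot v u / dot u u) *: u); first by rewrite memvD ?memvZ.
move=> x xX; pose c := dot x u / dot u u.
have x'in : x - c *: u \in (X :&: hyper u)%VS.
  by rewrite memv_cap memv_hyper memvB ?memvZ //= dotBl dotZl /c divfK ?subrr ?eqxx.
have ux' : dot u (x - c *: u) = 0.
  by rewrite dotC; move: x'in; rewrite memv_cap memv_hyper => /andP[_ /eqP].
rewrite -[x](subrK (c *: u)) dotDr dotZr opprD addrA (dotBl (v - a')) Ha' //.
rewrite dotZl ux' mulr0 subrr add0r !dotBl dotZl a'u subr0 divfK //.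
by rewrite subrr mulr0.
Qed.

Lemma orth_vector X : X != fullv -> exists2 h, h != 0 & (X <= hyper h)%VS.
Proof.
move=> Xf; have [v vX] : exists v, v \notin X.
  have : ~~ (fullv <= X)%VS by apply: contra Xf; rewrite eqEsubv subvf.
  by case/subvPn => v _ vX; exists v.
have [a aX Ha] := orth_decomp X v; exists (v - a).
  by apply: contraNneq vX => /eqP; rewrite subr_eq0 => /eqP ->.
by apply/subvP => x xX; rewrite memv_hyper dotC Ha.
Qed.

Lemma dim_orth_compl T : (\dim (orth_compl T) + \dim <<T>>)%N = d.
Proof.
have orth x y : x \in orth_compl T -> y \in <<T>>%VS -> dot x y = 0.
  move=> /orth_complP xT; have /subvP sT : (<<T>> <= hyper x)%VS.
    by apply/span_subvP => h hT; rewrite memv_hyper dotC xT.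
  by move/sT; rewrite memv_hyper dotC => /eqP.
have dk : (orth_compl T :&: <<T>>)%VS = 0%VS.
  apply/eqP; rewrite -subv0; apply/subvP => x; rewrite memv_cap => /andP[xk xs].
  by rewrite memv0 -dot_eq0 (orth x x).
rewrite -dimv_disjoint_sum //.
suff -> : (orth_compl T + <<T>> = fullv)%VS by rewrite dimvf /dim /= mul1n.
apply/eqP; rewrite eqEsubv subvf; apply/subvP => v _.
have [a aT Ha] := orth_decomp <<T>> v; rewrite -(subrK a v) memv_add //.
by apply/orth_complP => h hT; apply: Ha; apply: memv_span.
Qed.

Lemma dim_orth_compl_free T : free T -> \dim (orth_compl T) = (d - size T)%N.
Proof. by move/eqnP=> fT; have := dim_orth_compl T; rewrite fT; move: (\dim _) (size _) => a c; lia. Qed.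

End Orthogonality.

(** * Counting the cells of a Weyl arrangement *)

Section Counting.
Variables (R : realFieldType) (d : nat).
Implicit Types (h z v : 'rV[R]_d) (V : {vspace 'rV[R]_d}).
Implicit Types (s hs F : seq 'rV[R]_d).

(** The recursion is deletion and restriction; a hyperplane that contains [V]
    leaves no point for a cell. *)
Fixpoint count_cells V s : nat :=
  if s is h :: s' then
    if (V <= hyper h)%VS then 0%N else (count_cells V s' + count_cells (V :&: hyper h) s')%N
  else 1%N.

Lemma count_cells_eq0 V g s : g \in s -> (V <= hyper g)%VS -> count_cells V s = 0%N.
Proof.
elim: s V => //= h s IH V; rewrite inE => /predU1P[<- -> //|gs Vg].
by case: ifP => // _; rewrite !IH // (subv_trans (capvSl _ _)).
Qed.

(** The cells of [s] avoid the hyperplane of [g], so [h] does not cut them. *)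
Lemma count_cells_redundant V g h s :
  g \in s -> (V :&: hyper h <= hyper g)%VS -> count_cells V (h :: s) = count_cells V s.
Proof.
move=> gs VhG /=; rewrite (count_cells_eq0 gs VhG) addn0; case: ifP => // Vh.
by rewrite (count_cells_eq0 gs) //; move/capv_idPl: Vh VhG => ->.
Qed.

Lemma count_cells_redundants V hs s :
  {in hs, forall h, exists2 g, g \in s & (V :&: hyper h <= hyper g)%VS} ->
  count_cells V (hs ++ s) = count_cells V s.
Proof.
elim: hs => //= h hs IH Hhs; have [g gs Vg] := Hhs h (mem_head _ _).
rewrite -IH => [|h' h'hs]; last by apply: Hhs; rewrite inE h'hs orbT.
by apply: (count_cells_redundant (g := g)) => //; rewrite mem_cat gs orbT.
Qed.

(** The hyperplanes of [hs] may be added as if the others were not there: on each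
    of them, the traces of the later ones are redundant. *)
Lemma count_cells_cat V hs s :
  {in hs, forall h, ~~ (V <= hyper h)%VS} ->
  pairwise (fun h h' =>
    has (fun g => hyper h :&: hyper h' <= hyper g)%VS s) hs ->
  count_cells V (hs ++ s) = (count_cells V s + \sum_(h <- hs) count_cells (V :&: hyper h) s)%N.
Proof.
elim: hs => [|h hs IH] Vhs; first by rewrite big_nil addn0.
rewrite pairwise_cons => /andP[/allP hhs pw] /=.
rewrite (negPf (Vhs _ (mem_head _ _))) big_cons IH //; last first.
  by move=> h' h'hs; apply: Vhs; rewrite inE h'hs orbT.
rewrite [count_cells _ (hs ++ s)]count_cells_redundants; first by lia.
move=> h' /hhs /hasP[g gs Hg]; exists g => //.
by apply: subv_trans Hg; rewrite -capvA capvSr.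
Qed.

Variables (b : bool) (I : eqType) (y : I -> 'rV[R]_d).
Implicit Types (l : seq I).

(** The flag [b] stands for type B. A point [y i] put in front of the points
    [y j], [j] in [l], contributes the normals [y i - z], where [z] runs through
    these points in type A, and through these points, their opposites and the
    origin in type B. *)
Fixpoint targets l : seq 'rV[R]_d :=
  if l is i :: l' then y i :: (if b then [:: - y i] else [::]) ++ targets l'
  else nseq b 0.

Fixpoint weyl_normals l : seq 'rV[R]_d :=
  if l is i :: l' then [seq y i - z | z <- targets l'] ++ weyl_normals l' else [::].

(** To describe a flat, let each point either be new or coincide with one of its
    targets. The list records the normals of the coincidences, so that its length
    is the codimension of the flat. *)
Fixpoint flats l : seq (seq 'rV[R]_d) :=
  if l is i :: l' then
    flats l' ++ [seq (y i - z) :: F | F <- flats l', z <- targets l']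
  else [:: [::]].

(** The truncated subtraction covers the flats that are reduced to 0. *)
Definition generic_flats m V l :=
  {in flats l, forall F, \dim (V :&: orth_compl F) = (m - size F)%N}.

Definition ntargets n : nat := if b then (2 * n + 1)%N else n.

Lemma size_targets l : size (targets l) = ntargets (size l).
Proof.
rewrite /ntargets; elim: l => [|i l IH] /=; first by rewrite size_nseq; case: (b).
by rewrite size_cat IH; case: (b) => /=; lia.
Qed.

Lemma targetsN l z : b -> z \in targets l -> - z \in targets l.
Proof.
move=> bT; rewrite /targets; case: b bT => // _; elim: l => [|i l IH] /=.
  by rewrite !inE oppr_eq0.
rewrite !inE => /or3P[/eqP->|/eqP->|/IH ->]; rewrite ?opprK ?eqxx ?orbT //.
Qed.

Lemma hyperN h : hyper (- h) = hyper h.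
Proof. by apply/vspaceP => v; rewrite !memv_hyper dotNr oppr_eq0. Qed.

Lemma hyper_sub2 h h' g : g = h - h' \/ g = h' - h ->
  (hyper h :&: hyper h' <= hyper g)%VS.
Proof.
move=> Hg; apply/subvP => v; rewrite memv_cap !memv_hyper => /andP[/eqP vh /eqP vh'].
by case: Hg => ->; rewrite dotBr vh vh' subrr.
Qed.

(** Two hyperplanes through a new point meet inside a hyperplane of the old
    arrangement: if [v] gives [w], [z] and [z'] the same value, then it does not
    separate [z] from [z']. *)
Lemma targets_pairwise l (w : 'rV[R]_d) :
  pairwise (fun h h' =>
    has (fun g => hyper h :&: hyper h' <= hyper g)%VS (weyl_normals l))
    [seq w - z | z <- targets l].
Proof.
rewrite pairwise_map.
suff : pairwise (fun z z' => has (fun g => hyper (z - z') <= hyper g)%VS (weyl_normals l))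
         (targets l).
  apply: sub_pairwise => z z' /hasP[g gs Hg]; apply/hasP; exists g => //.
  by apply: subv_trans Hg; apply: hyper_sub2; right; rewrite opprB [RHS]addrC addrA subrK.
elim: l => [|i l IH] /=; first by case: b.
have sub z z' : has (fun g => hyper (z - z') <= hyper g)%VS (weyl_normals l) ->
  has (fun g => hyper (z - z') <= hyper g)%VS ([seq y i - z | z <- targets l] ++ weyl_normals l).
  by rewrite has_cat => ->; rewrite orbT.
have new z : z \in targets l ->
  has (fun g => hyper (y i - z) <= hyper g)%VS ([seq y i - z | z <- targets l] ++ weyl_normals l).
  move=> zl; apply/hasP; exists (y i - z) => //.
  by rewrite mem_cat; apply/orP; left; apply/mapP; exists z.
have IH' := sub_pairwise sub IH.
apply/andP; split; last first.
  move: (@targetsN l); case: (b) => //= tN; rewrite IH' andbT; apply/allP => z zl.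
  by rewrite -opprD hyperN -[z]opprK new // tN.
rewrite all_cat; apply/andP; split; last by apply/allP => z /new.
case bT: b => //=; rewrite andbT.
suff z0 : 0 \in targets l.
  have /hasP[g gs Hg] := new _ z0; apply/hasP; exists g => //.
  apply: subv_trans Hg; apply/subvP => v; rewrite !memv_hyper subr0 opprK dotDr.
  by rewrite -mulr2n mulrn_eq0.
by rewrite /targets bT; elim: (l) => [|j l' IHl] /=; rewrite !inE ?eqxx // IHl !orbT.
Qed.

Lemma generic_flats_dim m V l : generic_flats m V l -> \dim V = m.
Proof.
have nilF : [::] \in flats l by elim: l => //= i l IH; rewrite mem_cat IH.
by move=> /(_ _ nilF); rewrite orth_compl_nil capvf subn0.
Qed.

Lemma generic_flats_behead m V i l : generic_flats m V (i :: l) -> generic_flats m V l.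
Proof. by move=> gp F Fl; apply: gp; rewrite mem_cat Fl. Qed.

Lemma generic_flats_cap m V i l z : z \in targets l -> generic_flats m V (i :: l) ->
  generic_flats m.-1 (V :&: hyper (y i - z)) l.
Proof.
move=> zl gp F Fl; rewrite -capvA -orth_compl_cons gp /=; first by lia.
by rewrite mem_cat; apply/orP; right; apply/allpairsP; exists (F, z).
Qed.

Lemma generic_flats_nsub m V i l z : z \in targets l -> generic_flats m.+1 V (i :: l) ->
  ~~ (V <= hyper (y i - z))%VS.
Proof.
move=> zl gp; have := generic_flats_dim (generic_flats_cap zl gp); have := generic_flats_dim gp.
by move=> dV /= eV; apply/negP => /capv_idPl eV'; move: eV; rewrite eV' dV; lia.
Qed.

End Counting.

(** Both polynomials of the theorem have the shape
    (t + c_0) ... (t + c_(n-1)), where c_i is the number of hyperplanes that the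
    (i + 1)-st point contributes. *)
Definition stirling (b : bool) (n k : nat) : nat :=
  ((\prod_(i < n) ('X + (ntargets b i)%:R%:P) : {poly nat})`_k)%R.

Definition weyl_number (b : bool) (m k : nat) : nat :=
  (2 * \sum_(i < k | (k <= m + 1 + 2 * i)%N) stirling b m (m + 1 + 2 * i - k))%N.

Lemma stirling0 b k : stirling b 0 k = (k == 0%N).
Proof. by rewrite /stirling big_ord0 coef1; case: (k == 0%N). Qed.

Lemma stirlingS b n k : stirling b n.+1 k =
  ((if k is k'.+1 then stirling b n k' else 0) + ntargets b n * stirling b n k)%N.
Proof.
rewrite /stirling big_ord_recr /= mulrDr coefD coefMX coefMC mulrC natn.
by case: k.
Qed.

Lemma stirling_gt b n k : (n < k)%N -> stirling b n k = 0%N.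
Proof.
elim: n k => [|n IH] [|k] //; first by rewrite stirling0.
by rewrite stirlingS => ltnk; rewrite !IH // ?muln0 // ltnW.
Qed.

Lemma weyl_number0 b n : weyl_number b n 0 = 0%N.
Proof. by rewrite /weyl_number big_ord0. Qed.

Lemma weyl_numberS b n k :
  weyl_number b n.+1 k.+1 = (weyl_number b n k.+1 + ntargets b n * weyl_number b n k)%N.
Proof.
rewrite /weyl_number mulnCA -mulnDr; congr (2 * _)%N.
(* The term at [i = k] is a coefficient beyond the degree. *)
have -> : (\sum_(i < k | k <= n + 1 + 2 * i) stirling b n (n + 1 + 2 * i - k) =
  \sum_(i < k.+1 | k <= n + 1 + 2 * i) stirling b n (n + 1 + 2 * i - k))%N.
  rewrite [RHS]big_mkcond big_ord_recr /= [X in _ = (_ + X)%N](_ : _ = 0%N).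
    by rewrite addn0 [LHS]big_mkcond; apply: eq_bigr.
  by case: ifP => // _; rewrite stirling_gt //; lia.
rewrite big_distrr /= [X in _ = (X + _)%N]big_mkcond /= [X in _ = (_ + X)%N]big_mkcond /=.
rewrite -big_split big_mkcond; apply: eq_bigr => i _ /=.
have -> : (k < n.+1 + 1 + 2 * i)%N = (k <= n + 1 + 2 * i)%N by lia.
have -> : (n.+1 + 1 + 2 * i - k.+1 = n + 1 + 2 * i - k)%N by lia.
case: (ltngtP k (n + 1 + 2 * i)) => [lt|//|eq].
  have -> : (n + 1 + 2 * i - k = (n + 1 + 2 * i - k.+1).+1)%N by lia.
  by rewrite stirlingS.
by rewrite (_ : n + 1 + 2 * i - k = 0)%N ?stirlingS; last lia.
Qed.

Lemma sum_odd k : (\sum_(i < k) (k == 2 * i + 1) = odd k)%N.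
Proof.
case: (boolP (odd k)) => ok; last first.
  by rewrite big1 // => i _; apply/eqP; rewrite eqb0; apply: contra ok => /eqP ->; lia.
have ltk : (k./2 < k)%N by lia.
rewrite (bigD1 (Ordinal ltk)) //= big1 => [|i]; first by have -> : (k == 2 * k./2 + 1)%N by lia.
by rewrite -val_eqE /= => ik; apply/eqP; rewrite eqb0; apply: contra ik => /eqP; lia.
Qed.

(** Before the only hyperplane comes in, the polynomial is t or 1, and the sum is 2
    in odd dimensions and 0 in even ones; the recursion adds up two consecutive
    dimensions. *)
Lemma weyl_number1 b n k : ntargets b n = 1%N -> weyl_number b n.+1 k.+1 = 2%N.
Proof.
move=> n1; suff E j : weyl_number b n j = (2 * odd j)%N by rewrite weyl_numberS n1 !E /=; lia.
rewrite /weyl_number -sum_odd; congr (2 * _)%N; rewrite big_mkcond; apply: eq_bigr => i _.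
move: n1; rewrite /ntargets; case: b => n1.
  have -> : n = 0%N by lia.
  by rewrite stirling0; case: leqP => ?; lia.
have -> : n = 1%N by lia.
rewrite stirlingS; case: leqP => [|?]; last by lia.
case E : (1 + 1 + 2 * i - j)%N => [|m] le; first by rewrite /ntargets mul0n; lia.
by rewrite /ntargets mul0n addn0 stirling0; lia.
Qed.

(** The number of cells of the arrangement, from the recursion
    N(n + 1, m) = N(n, m) + c_n N(n, m - 1): the c_n hyperplanes of the new point
    are added one at a time, and each of them cuts as many cells in two as the
    arrangement of the old points has cells inside that hyperplane. *)
Lemma count_cells_weyl (R : realFieldType) (d : nat) (b : bool) (I : eqType)
    (y : I -> 'rV[R]_d) (m : nat) (V : {vspace 'rV[R]_d}) (i : I) (l : seq I) :
  (0 < size (targets b y l))%N -> generic_flats b y m V (i :: l) ->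
  count_cells V (weyl_normals b y (i :: l)) = weyl_number b (size l).+1 m.
Proof.
elim: l i m V => [|j l IH] i m V sz gp.
  (* One point: type B, with the hyperplane orthogonal to it. *)
  case: b sz gp => //= sz gp.
  have z0 : (0 : 'rV[R]_d) \in targets true y [::] by rewrite inE.
  case: m gp => [|m] gp.
    rewrite weyl_number0; case: ifP => // /negP[].
    by move/generic_flats_dim: gp => /eqP; rewrite dimv_eq0 => /eqP ->; rewrite sub0v.
  by rewrite (negPf (generic_flats_nsub z0 gp)) weyl_number1.
have [sz0|sz0] := posnP (size (targets b y l)).
  (* Two points in type A, with the hyperplane between them. *)
  have b0 : b = false /\ l = [::].
    by case: (b) (l) sz0 => [|] [|? ?].
  case: b0 sz gp => -> -> _ gp {IH sz0} /=.
  have z0 : y j \in targets false y [:: j] by rewrite inE.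
  case: m gp => [|m] gp.
    rewrite weyl_number0; case: ifP => // /negP[].
    by move/generic_flats_dim: gp => /eqP; rewrite dimv_eq0 => /eqP ->; rewrite sub0v.
  by rewrite (negPf (generic_flats_nsub z0 gp)) weyl_number1.
case: m gp => [|m] gp.
  rewrite weyl_number0; have := mem_nth 0 sz; set z := nth _ _ _ => zl.
  apply: (@count_cells_eq0 _ _ _ (y i - z)).
    by rewrite mem_cat; apply/orP; left; apply/mapP; exists z.
  by move/generic_flats_dim: gp => /eqP; rewrite dimv_eq0 => /eqP ->; rewrite sub0v.
have -> : weyl_normals b y [:: i, j & l] =
  [seq y i - z | z <- targets b y (j :: l)] ++ weyl_normals b y (j :: l) by [].
rewrite count_cells_cat; last exact: targets_pairwise; last first.
  by move=> h /mapP[z zl ->]; apply: generic_flats_nsub zl gp.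
rewrite (IH _ m.+1) //; last exact: generic_flats_behead gp.
rewrite [RHS]weyl_numberS; congr (_ + _)%N.
rewrite big_map big_seq_cond (eq_bigr (fun=> weyl_number b (size l).+1 m)) => [|z].
  by rewrite -big_seq_cond big_const_seq count_predT size_targets iter_addn_0 mulnC.
by rewrite andbT => zl; apply: IH; rewrite // -[m]/m.+1.-1; apply: generic_flats_cap zl gp.
Qed.

(** * General position and the dimensions of flats *)

Section LabelledPoints.
Variables (R : realType) (d : nat).
Implicit Types (v : 'rV[R]_d) (w P : seq (nat * 'rV[R]_d)) (t s F : seq 'rV[R]_d).

Lemma subseq_extend (T : eqType) (t s : seq T) k :
  subseq t s -> (size t <= k <= size s)%N ->
  exists u, [/\ subseq t u, subseq u s & size u = k].
Proof.
elim: s t k => [|x s IH] [|x' t] k //.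
- by rewrite leqn0 => _ /eqP ->; exists [::].
- move=> _ /andP[_ le]; exists (take k (x :: s)).
  by rewrite sub0seq take_subseq size_takel.
rewrite [subseq _ _]/=; case: eqP => [->|ne] ts /andP[lek leks].
  case: k lek leks => // k; rewrite /= !ltnS => lek leks.
  have [u [tu us <-]] := IH _ k ts (introT andP (conj lek leks)).
  by exists (x :: u); rewrite /= !eqxx.
have [le|gt] := leqP k (size s).
  have [u [tu us <-]] := IH _ k ts (introT andP (conj lek le)).
  by exists u; rewrite tu (subseq_trans us (subseq_cons _ _)).
exists (x :: s); split; rewrite ?(subseq_trans ts (subseq_cons _ _)) //.
by apply/eqP; rewrite eqn_leq gt leks.
Qed.

Lemma subseq_free t s : subseq t s -> free s -> free t.
Proof.
by move=> /[swap] fs /(subseq_uniqP (free_uniq fs)) ->; apply: filter_free.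
Qed.

Lemma mem_zip (S T : eqType) (s : seq S) (t : seq T) x y :
  (x, y) \in zip s t -> x \in s /\ y \in t.
Proof.
elim: s t => [|a s IH] [|c t] //=; rewrite inE => /predU1P[[-> ->]|/IH[xs yt]].
  by rewrite !inE !eqxx.
by rewrite !inE xs yt !orbT.
Qed.

Definition same_dot P v : Prop :=
  {in P &, forall p q, p.1 = q.1 -> dot v p.2 = dot v q.2}.

Definition block_diffs w : seq 'rV[R]_d :=
  [seq p.1.2 - p.2.2 | p <- zip w (behead w) & p.1.1 == p.2.1].

Lemma block_diffs_cons p q w : block_diffs [:: p, q & w] =
  (if p.1 == q.1 then [:: p.2 - q.2] else [::]) ++ block_diffs (q :: w).
Proof. by rewrite /block_diffs /=; case: ifP. Qed.

Lemma block_diffs_subseq w :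
  subseq (block_diffs w) (consecutive_diffs [seq p.2 | p <- w]).
Proof.
elim: w => [|p [|q w] IH] //; rewrite block_diffs_cons.
rewrite [consecutive_diffs _]/= -/(consecutive_diffs [seq p.2 | p <- q :: w]).
case: ifP => _; first by rewrite /= eqxx.
exact: subseq_trans IH (subseq_cons _ _).
Qed.

Definition label_geq : rel (nat * 'rV[R]_d) := fun p q => (q.1 <= p.1)%N.

Lemma label_geq_trans : transitive label_geq.
Proof. by move=> q p r pq qr; apply: leq_trans qr pq. Qed.

(** Each element starts a new label or contributes a difference. *)
Lemma size_block_diffs w : sorted label_geq w ->
  (size (block_diffs w) + size (undup [seq p.1 | p <- w]) = size w)%N.
Proof.
elim: w => [|p [|q w] IH] //= /andP[pq]; have := IH; rewrite /= => {}IH /[dup] qw /IH.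
rewrite block_diffs_cons size_cat inE; case: eqP => [_|ne] /=; first by move=> <-.
case: (boolP (p.1 \in _)) => [/mapP[r rw e]|_] /=; last by move=> <-; rewrite addnS.
have /allP/(_ _ rw) := order_path_min label_geq_trans qw.
by rewrite /label_geq -e => qp; case: ne; apply/eqP; rewrite eqn_leq qp; apply: pq.
Qed.

(** In a list sorted by label, the consecutive differences inside the blocks
    decide all the coincidences: equal labels are joined by a chain of equal
    labels. *)
Lemma block_diffsP w v : sorted label_geq w ->
  (v \in orth_compl (block_diffs w)) <-> same_dot w v.
Proof.
move=> srt; split=> [/orth_complP vk|sd]; last first.
  apply/orth_complP => h /mapP[[p q]]; rewrite mem_filter /= => /andP[/eqP e pq] ->.
  have [pw qw] := mem_zip pq.
  by rewrite dotBr (sd p q) ?subrr // (mem_behead qw).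
have key p u : sorted label_geq (p :: u) -> {in block_diffs (p :: u), forall h, dot v h = 0} ->
    {in u, forall q, p.1 = q.1 -> dot v p.2 = dot v q.2}.
  elim: u p => // q u IH p /= /andP[pq qu] H r; rewrite inE => ru e.
  have le_rq : (r.1 <= q.1)%N.
    case/predU1P: ru => [->//|ru].
    by have /allP/(_ _ ru) := order_path_min label_geq_trans qu.
  have epq : p.1 = q.1 by apply/eqP; rewrite eqn_leq e le_rq -e; apply: pq.
  have -> : dot v p.2 = dot v q.2.
    apply/eqP; rewrite -subr_eq0 -dotBr H // block_diffs_cons epq eqxx.
    exact: mem_head.
  case/predU1P: ru => [->//|ru]; apply: IH => //; last by rewrite -epq.
  by move=> h hq; apply: H; rewrite block_diffs_cons mem_cat hq orbT.
elim: w srt vk => [|p w IH] srt vk //.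
have sw := path_sorted srt.
have vw : {in block_diffs w, forall h, dot v h = 0}.
  case: w {IH srt} vk {sw} => // q w vk h hq; apply: vk.
  by rewrite block_diffs_cons mem_cat hq orbT.
move=> r q; rewrite !inE => /predU1P[->|rw] /predU1P[->|qw] // e.
- exact: (key p w).
- by apply/esym; apply: (key p w).
- exact: IH.
Qed.

(** The block differences are some of the consecutive differences. If there are
    at most [d] of them, they belong to [d] consecutive differences, which are
    independent; otherwise [d] of them are already a basis of the space. *)
Lemma dim_orth_compl_blocks w : (d < size w)%N -> sorted label_geq w ->
  any_free d (consecutive_diffs [seq p.2 | p <- w]) ->
  \dim (orth_compl (block_diffs w)) = (d - size (block_diffs w))%N.
Proof.
move=> dw srt fr; have sub := block_diffs_subseq w.
have [le|lt] := leqP (size (block_diffs w)) d.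
  apply: dim_orth_compl_free.
  have [|u [tu us su]] := subseq_extend (k := d) sub.
    by rewrite le /consecutive_diffs size_map size_zip size_behead size_map; lia.
  by apply: subseq_free tu _; apply: fr.
have f : free (take d (block_diffs w)).
  apply: fr; first exact: subseq_trans (take_subseq _ _) sub.
  by rewrite size_takel // ltnW.
have le0 : (orth_compl (block_diffs w) <= orth_compl (take d (block_diffs w)))%VS.
  by apply/subvP => v /orth_complP vk; apply/orth_complP => h /mem_take; apply: vk.
have := dimvS le0; rewrite (dim_orth_compl_free f) size_takel; last exact: ltnW.
by rewrite subnn leqn0 => /eqP ->; apply/esym/eqP; rewrite subn_eq0 ltnW.
Qed.

End LabelledPoints.

Section GeneralPositionFlats.
Variables (R : realType) (d : nat) (b : bool) (I : eqType) (y : I -> 'rV[R]_d).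
Implicit Types (l : seq I) (L : seq (nat * (bool * I))) (v : 'rV[R]_d).

(** In type B the origin is one more point. With its label 0 put last, the
    consecutive differences of the signed points and the origin are exactly the
    vectors that general position of type B speaks of. *)
Definition points L : seq (nat * 'rV[R]_d) :=
  [seq (p.1, (-1) ^+ p.2.1 *: y p.2.2) | p : nat * (bool * I) <- L] ++ nseq b (0%N, 0).

Lemma points_cons k c i L :
  points ((k, (c, i)) :: L) = (k, (-1) ^+ c *: y i) :: points L.
Proof. by []. Qed.

(** [L] labels the points of [l] so that the flat [orth_compl F] consists of the
    vectors that separate no two points with a common label; each normal in [F]
    merges two labels. *)
Definition labels_flat l (F : seq 'rV[R]_d) L : Prop :=
  [/\ [seq p.2.2 | p <- L] = l, all (fun p => p.2.1 ==> b) L,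
      forall v, v \in orth_compl F <-> same_dot (points L) v &
      (size F + size (undup [seq p.1 | p <- points L]) = size l + b)%N].

Lemma targets_points l L z :
  [seq p.2.2 | p <- L] = l -> all (fun p => p.2.1 ==> b) L -> z \in targets b y l ->
  exists (c : bool) q, [/\ q \in points L, z = (-1) ^+ c *: q.2 & c -> b].
Proof.
move=> <- {l}; elim: L => [|[k [e i]] L IH] eb.
  case bT : b => //=; rewrite ?inE => // /eqP ->.
  by exists false, (0%N, 0); rewrite /points bT inE scaler0.
have in0 : (k, (-1) ^+ e *: y i) \in points ((k, (e, i)) :: L) by rewrite mem_head.
have /andP[/implyP ebi eb'] := eb.
rewrite /= inE mem_cat => /or3P[/eqP ->|zN|zl].
- by exists e, (k, (-1) ^+ e *: y i); rewrite scalerA -expr2 sqrr_sign scale1r.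
- have [bT /eqP ->] : b /\ z == - y i by move: zN; case: (b); rewrite ?inE.
  exists (~~ e), (k, (-1) ^+ e *: y i); split => //.
  by rewrite signrN scaleNr /= scalerA -expr2 sqrr_sign scale1r.
have [c [q [qL ez cb]]] := IH eb' zl; exists c, q; split => //.
by rewrite /points /= inE qL orbT.
Qed.

Lemma fresh_label (s : seq nat) : exists k, k \notin s.
Proof.
exists (\max_(x <- s) x).+1; apply/negP => ks.
by have := leq_bigmax_seq (P := predT) (F := id) _ ks isT; rewrite ltnn.
Qed.

(** A coincidence with a target gives the new point the label of that target,
    with the sign that makes the two signed points coincide. *)
Lemma flats_labels l (F : seq 'rV[R]_d) : F \in flats b y l -> exists L, labels_flat l F L.
Proof.
elim: l F => [|i l IH] F /=.
  rewrite inE => /eqP ->; exists [::]; split => // [v|]; last by rewrite /points; case: (b).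
  rewrite orth_compl_nil memvf; split => // _ p q.
  by rewrite /points /= !mem_nseq => /andP[_ /eqP ->] /andP[_ /eqP ->].
rewrite mem_cat => /orP[/IH [L [eL eb HF sz]]|].
  have [k kL] := fresh_label [seq p.1 | p <- points L].
  exists ((k, (false, i)) :: L); split => [||v|]; first by rewrite /= eL.
  - by rewrite /= eb.
  - rewrite HF; split=> [sd p q|sd p q pL qL]; last by apply: sd; rewrite inE ?pL ?qL orbT.
    rewrite !inE => /predU1P[->|pL] /predU1P[->|qL] //= e.
    + by case/negP: kL; apply/mapP; exists q.
    + by case/negP: kL; apply/mapP; exists p.
    + exact: sd.
  - by move: kL sz; rewrite /points /= => /negPf ->; rewrite /=; lia.
case/allpairsP => -[F' z] /= [/IH [L [eL eb HF sz]] zl ->].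
have [c [q [qL ez cb]]] := targets_points eL eb zl.
exists ((q.1, (c, i)) :: L); split => [||v|]; first by rewrite /= eL.
- by rewrite /= eb andbT; apply/implyP.
- have Ez : (v \in hyper (y i - z)) = (dot v ((-1) ^+ c *: y i) == dot v q.2).
    rewrite memv_hyper dotBr subr_eq0 ez !dotZr; case: (c).
      by rewrite expr1 !mulN1r eqr_oppLR.
    by rewrite expr0 !mul1r.
  rewrite orth_compl_cons memv_cap Ez; split=> [/andP[/eqP e /HF sd] p1 p2|sd].
    rewrite !inE => /predU1P[->|p1L] /predU1P[->|p2L] //= e12.
    + by rewrite e; apply: sd.
    + by rewrite e; apply: sd.
    + exact: sd.
  apply/andP; split; last first.
    by apply/HF => p1 p2 p1L p2L; apply: sd; rewrite inE ?p1L ?p2L orbT.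
  by apply/eqP; apply: (sd (q.1, (-1) ^+ c *: y i) q); rewrite ?mem_head // inE qL orbT.
- by rewrite points_cons [undup _]/= (map_f fst qL) [size (_ :: F')]/= addSn sz.
Qed.

End GeneralPositionFlats.

Definition general_position (R : realType) (d n : nat) (b : bool)
    (y : 'I_n -> 'rV[R]_d) : Prop :=
  if b then general_positionB y else general_positionA y.

Section FlatsInGeneralPosition.
Variables (R : realType) (d n : nat) (b : bool) (y : 'I_n -> 'rV[R]_d).
Implicit Types L : seq (nat * (bool * 'I_n)).

Lemma general_position_size : general_position b y -> (d < n + b)%N.
Proof. by rewrite /general_position; case: (b) => -[]; lia. Qed.

Lemma perm_of_list L : perm_eq [seq p.2.2 | p <- L] (enum 'I_n) ->
  exists (e : 'I_n -> bool) (sigma : 'S_n),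
    [seq (-1) ^+ e i *: y (sigma i) | i <- enum 'I_n] =
    [seq (-1) ^+ p.2.1 *: y p.2.2 | p : nat * (bool * 'I_n) <- L] /\
    (all (fun p => ~~ p.2.1) L -> forall i, e i = false).
Proof.
move=> pL; have sL : size L = n by have := perm_size pL; rewrite size_map size_enum_ord.
pose f i := nth (0%N, (false, i)) L i.
have f_in i : f i \in L by rewrite mem_nth ?sL.
have fE (i j : 'I_n) : nth (0%N, (false, i)) L j = f j.
  by apply: set_nth_default; rewrite sL.
have inj : injective (fun i => (f i).2.2).
  move=> i j eij; apply: val_inj; apply/eqP.
  have uL : uniq [seq p.2.2 | p <- L] by rewrite (perm_uniq pL) enum_uniq.
  have ltL (k : 'I_n) : (\val k < size L)%N by rewrite sL; apply: ltn_ord.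
  have ltL' (k : 'I_n) : (\val k < size [seq p.2.2 | p <- L])%N by rewrite size_map.
  rewrite -(nth_uniq i (ltL' i) (ltL' j) uL).
  rewrite (nth_map (0%N, (false, i)) i _ (ltL i)) (nth_map (0%N, (false, i)) i _ (ltL j)).
  by rewrite (fE i i) (fE i j) eij.
exists (fun i => (f i).2.1), (perm inj); split; last first.
  by move=> /allP aL i; apply/negbTE/aL.
apply: (@eq_from_nth _ 0) => [|k]; rewrite size_map -?enumT size_enum_ord.
  by rewrite size_map sL.
move=> ltk.
rewrite (nth_map (Ordinal ltk)) ?size_enum_ord //.
rewrite (nth_map (0%N, (false, Ordinal ltk))) ?sL // permE.
have -> : nth (Ordinal ltk) (enum 'I_n) k = Ordinal ltk.
  by apply: val_inj; rewrite /= nth_enum_ord.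
by rewrite /f.
Qed.

Lemma general_position_free L :
  general_position b y -> perm_eq [seq p.2.2 | p <- L] (enum 'I_n) ->
  all (fun p => p.2.1 ==> b) L ->
  any_free d (consecutive_diffs [seq p.2 | p <- points b y L]).
Proof.
move=> gp /perm_of_list [e [sigma [eL e0]]] eb.
have E : [seq p.2 | p <- points b y L] =
    [seq (-1) ^+ e i *: y (sigma i) | i <- enum 'I_n] ++ nseq b 0.
  by rewrite map_cat eL -map_comp; case: (b).
move: gp; rewrite E /general_position; case: (b) eb => eb [_ gp].
  have := gp e sigma; rewrite cats1; set z := [seq _ | i <- _].
  suff sub : subseq (consecutive_diffs (rcons z 0)) (rcons (consecutive_diffs z) (last 0 z)).
    by move=> fr t ts; apply: fr; apply: subseq_trans ts sub.
  case: z => // x z; suff -> : consecutive_diffs (rcons (x :: z) 0) =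
    rcons (consecutive_diffs (x :: z)) (last 0 (x :: z)) by [].
  elim: z x => [|x' z IH] x; first by rewrite /consecutive_diffs /= subr0.
  by have := IH x'; rewrite /consecutive_diffs /= => [[->]].
have {}e0 : forall i, e i = false.
  by apply: e0; apply: sub_all eb => p /implyP; case: (p.2.1) => // /(_ isT).
by under eq_map => i do rewrite e0 scale1r; rewrite cats0; apply: gp.
Qed.

(** For the whole space, the dimension formula is a restatement of general
    position: listing the points block by block turns the normals of the flat
    into consecutive differences. *)
Lemma generic_flats_full : general_position b y -> generic_flats b y d fullv (enum 'I_n).
Proof.
move=> gp F /flats_labels [L [eL eb HF sz]]; rewrite capfv.
pose r : rel (nat * (bool * 'I_n)) := fun p q => (q.1 <= p.1)%N.
have rtr : transitive r by move=> q p t pq qt; apply: leq_trans qt pq.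
have pLL : perm_eq (sort r L) L by rewrite perm_sort.
pose w := points b y (sort r L).
have pw : perm_eq w (points b y L) by rewrite perm_cat2r perm_map.
have sw : size w = (n + b)%N.
  by rewrite size_cat size_map size_sort size_nseq -(size_map (fun p => p.2.2)) eL size_enum_ord.
have srt : sorted (@label_geq R d) w.
  rewrite (sorted_pairwise (@label_geq_trans R d)) pairwise_cat; apply/and3P; split.
  - by apply/allrelP => p q _; rewrite mem_nseq => /andP[_ /eqP ->].
  - rewrite pairwise_map -(sorted_pairwise rtr); apply: sort_sorted.
    by move=> p q; apply: leq_total.
  - by case: (b).
have fr : any_free d (consecutive_diffs [seq p.2 | p <- w]).
  apply: general_position_free => //; last by rewrite (perm_all _ pLL).
  by rewrite -eL perm_map.
have -> : orth_compl F = orth_compl (block_diffs w).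
  apply/vspaceP => v; apply/idP/idP => [/HF sd|/(block_diffsP _ srt) sd].
    by apply/block_diffsP => // p q; rewrite !(perm_mem pw); apply: sd.
  by apply/HF => p q; rewrite -!(perm_mem pw); apply: sd.
rewrite dim_orth_compl_blocks ?sw ?general_position_size //; congr (d - _)%N.
have := size_block_diffs srt; rewrite sw => {}sw.
move: sz; rewrite size_enum_ord -(perm_size (perm_undup (perm_mem (perm_map fst pw)))) => sz.
by apply: (@addIn (size (undup [seq p.1 | p <- w]))); rewrite sz sw.
Qed.

End FlatsInGeneralPosition.

(** * Sign patterns of cells *)

Section SignPatterns.
Variables (R : realType) (d : nat).
Implicit Types (v h x c l : 'rV[R]_d) (V L : {vspace 'rV[R]_d}).
Implicit Types (s : seq 'rV[R]_d) (o : seq bool).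

Definition realizes s o v : bool :=
  all2 (fun h (b : bool) => if b then 0 < dot v h else dot v h < 0) s o.

Definition wrealizes s o v : bool :=
  all2 (fun h (b : bool) => if b then 0 <= dot v h else dot v h <= 0) s o.

Lemma realizes_cons h s b o v : realizes (h :: s) (b :: o) v =
  (if b then 0 < dot v h else dot v h < 0) && realizes s o v.
Proof. by []. Qed.

Definition realizable V s o : Prop := exists2 v, v \in V & realizes s o v.

Definition cells V s : {set (size s).-tuple bool} :=
  [set o : (size s).-tuple bool | `[< realizable V s o >]].

Lemma cellsP V s (o : (size s).-tuple bool) :
  reflect (realizable V s o) (o \in cells V s).
Proof. by rewrite inE; apply: asboolP. Qed.

Lemma realizes_wrealizes s o v : realizes s o v -> wrealizes s o v.
Proof.
elim: s o => [|h s IH] [|b o] //= /andP[hb /IH ->]; rewrite andbT.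
by case: b hb => /ltW.
Qed.

Lemma pos_perturb (a e : R) : 0 <= a -> (a = 0 -> 0 < e) ->
  exists2 r, 0 < r & forall t, 0 < t <= r -> 0 < a + t * e.
Proof.
move=> a0 ae; have [a0'|] := eqVneq a 0.
  by exists 1 => // t /andP[t0 _]; rewrite a0' add0r mulr_gt0 // ae.
move=> an0; have {a0 an0 ae} a0 : 0 < a by rewrite lt_neqAle eq_sym an0.
have p1 : 0 < `|e| + 1 by have := normr_ge0 e; lra.
exists (a / (`|e| + 1)) => [|t /andP[t0 tr]]; first by rewrite divr_gt0.
have : t * (`|e| + 1) <= a by rewrite -ler_pdivlMr.
have : t * (- `|e|) <= t * e by rewrite ler_wpM2l ?(ltW t0) // lerNl -normrN ler_norm.
by nra.
Qed.

(** Moving from a point [x] of the closed cell in a direction that points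
    inwards on the walls through [x] enters the open cell. *)
Lemma realizes_perturb s o x c l :
  realizes s o c -> wrealizes s o x ->
  {in s, forall h, dot x h = 0 -> dot l h = dot c h} ->
  exists2 r, 0 < r & forall t, 0 < t <= r -> realizes s o (x + t *: l).
Proof.
elim: s o => [|h s IH] [|b o] //=; first by exists 1.
move=> /andP[ch cs] /andP[xh xs] H.
have [r1 r10 H1] : exists2 r, 0 < r & forall t, 0 < t <= r ->
    if b then 0 < dot (x + t *: l) h else dot (x + t *: l) h < 0.
  have Hh := H h (mem_head _ _); case: b ch xh => ch xh.
    have [|r r0 Hr] := @pos_perturb _ (dot l h) xh; first by move/Hh ->.
    by exists r => // t /Hr; rewrite dotDl dotZl.
  have [||r r0 Hr] := @pos_perturb (- dot x h) (- dot l h).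
  - by rewrite oppr_ge0.
  - by move/eqP; rewrite oppr_eq0 => /eqP /Hh ->; rewrite oppr_gt0.
  by exists r => // t /Hr; rewrite dotDl dotZl mulrN -opprD oppr_gt0.
have [|r2 r20 H2] := IH o cs xs; first by move=> g gs; apply: H; rewrite inE gs orbT.
exists (Num.min r1 r2) => [|t]; first by rewrite lt_min r10.
by rewrite le_min => /and3P[t0 t1 t2]; rewrite H1 ?H2 ?t0.
Qed.

Lemma realizes_nudge s o v w : realizes s o v ->
  exists2 r, 0 < r & realizes s o (v + r *: w).
Proof.
move=> vo; have [|r r0 Hr] := realizes_perturb (l := w) vo (realizes_wrealizes vo).
  elim: s o vo => // h s IH [|b o] //= /andP[vh vs] g.
  rewrite inE => /predU1P[->|gs]; last exact: IH vs _ gs.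
  by move=> v0; move: vh; rewrite v0 ltxx; case: (b).
by exists r => //; apply: Hr; rewrite r0 lexx.
Qed.

Lemma realizes_comb s o v w a e : realizes s o v -> realizes s o w ->
  0 <= a -> 0 <= e -> 0 < a + e -> realizes s o (a *: v + e *: w).
Proof.
move=> vo wo a0 e0 ae; elim: s o vo wo => [|h s IH] [|b o] //= /andP[vh vs] /andP[wh ws].
rewrite IH // andbT dotDl !dotZl; case: b vh wh => vh wh.
  have [a0'|an] := eqVneq a 0; first by move: ae; rewrite a0' !(mul0r, add0r) => e0'; apply: mulr_gt0.
  by apply: ltr_pwDl; [apply: mulr_gt0 => //; rewrite lt_neqAle eq_sym an|apply: mulr_ge0 => //; apply: ltW].
rewrite -oppr_gt0 opprD -!mulrN.
have [a0'|an] := eqVneq a 0; first by move: ae; rewrite a0' !(mul0r, add0r) => e0'; apply: mulr_gt0; rewrite ?oppr_gt0.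
apply: ltr_pwDl; first by apply: mulr_gt0; rewrite ?oppr_gt0 // lt_neqAle eq_sym an.
by apply: mulr_ge0 => //; rewrite oppr_ge0 ltW.
Qed.

Lemma card_tuple_cons n (P : pred (n.+1.-tuple bool)) :
  #|[set t | P t]%SET| = (#|[set t : n.-tuple bool | P [tuple of true :: t]]%SET| +
                          #|[set t : n.-tuple bool | P [tuple of false :: t]]%SET|)%N.
Proof.
pose f b (t : n.-tuple bool) := [tuple of b :: t].
have fI b : injective (f b) by move=> t u /(congr1 val) [] /val_inj.
pose A b := [set t : n.-tuple bool | P (f b t)]%SET.
have -> : [set t | P t]%SET = (f true @: A true) :|: (f false @: A false).
  apply/finset.setP => t; rewrite !inE; apply/idP/orP => [Pt|].
    have Et : t = f (thead t) [tuple of behead t] by rewrite /f -tuple_eta.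
    have : [tuple of behead t] \in A (thead t) by rewrite inE -Et.
    by case: (thead t) Et => Et tA; [left|right]; apply/imsetP; exists [tuple of behead t].
  by case=> /imsetP[u]; rewrite inE => Pu ->.
rewrite cardsU !card_imset //; set I := _ :&: _.
suff -> : I = finset.set0 by rewrite cards0 subn0.
apply/finset.setP => t; rewrite !inE; apply/negP => /andP[/imsetP[u _ ->] /imsetP[w _]].
by move/(congr1 val).
Qed.

(** Adding a hyperplane cuts in two exactly the cells that it meets, that is
    the cells of the arrangement restricted to the hyperplane. *)
Lemma card_cells V s : #|cells V s| = count_cells V s.
Proof.
elim: s V => [|h s IH] V.
  rewrite (_ : cells V [::] = [set: _]%SET) ?cardsT ?card_tuple ?expn0 //.
  by apply/finset.setP => o; rewrite inE finset.in_setT; apply/asboolP; exists 0; rewrite ?mem0v // tuple0.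
rewrite [count_cells _ _]/=; case: ifPn => [/subvP Vh|/not_sub_hyper[w wV wh]].
  apply/eqP; rewrite cards_eq0; apply/eqP/finset.setP => o; rewrite inE finset.in_set0.
  apply/asboolP => -[v /Vh]; rewrite memv_hyper => /eqP v0.
  by case/tupleP: o => b o; rewrite /realizes /= v0 ltxx; case: b.
rewrite -!IH card_tuple_cons -cardsUI; congr (_ + _)%N; apply: eq_card => o.
  rewrite inE [in RHS]inE; apply/orP/asboolP => [[]|[v vV vo]].
  - by rewrite inE => /asboolP[v vV /andP[_ vo]]; exists v.
  - by rewrite inE => /asboolP[v vV /andP[_ vo]]; exists v.
  have [v0|vn] := eqVneq (dot v h) 0; last first.
    case: (ltgtP (dot v h) 0) vn => // vh _; [right|left];
      by rewrite inE; apply/asboolP; exists v => //; rewrite /realizes /= vh.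
  have [r r0 Hr] := realizes_nudge w vo.
  have vrV : v + r *: w \in V by rewrite memvD ?memvZ.
  have E : dot (v + r *: w) h = r * dot w h by rewrite dotDl v0 add0r dotZl.
  case: (ltgtP (dot w h) 0) wh => // wh _; [right|left]; rewrite inE; apply/asboolP;
    exists (v + r *: w) => //; rewrite realizes_cons E Hr andbT.
    by rewrite pmulr_rlt0.
  by rewrite pmulr_rgt0.
rewrite inE [in RHS]inE; apply/andP/asboolP => [[]|[v]].
  rewrite !inE => -[v vV /andP[vh vo]] [u uV /andP[uh uo]].
  exists (- dot u h *: v + dot v h *: u).
    by rewrite memv_cap memvD ?memvZ //= memv_hyper dotDl !dotZl mulrC mulrN addNr.
  by apply: realizes_comb; rewrite ?oppr_ge0 ?(ltW vh) ?(ltW uh) // ltr_wpDr ?oppr_gt0 // ltW.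
rewrite memv_cap memv_hyper => /andP[vV /eqP v0] vo.
have key w' : w' \in V -> exists2 u, u \in V & realizes s o u /\ exists2 r, 0 < r & dot u h = r * dot w' h.
  move=> w'V; have [r r0 Hr] := realizes_nudge w' vo.
  exists (v + r *: w'); first by rewrite memvD ?memvZ.
  by split=> //; exists r => //; rewrite dotDl v0 add0r dotZl.
have [u1 u1V [u1o [r1 r10 E1]]] := key w wV.
have [|u2 u2V [u2o [r2 r20 E2]]] := key (- w); first by rewrite memvN.
by case: (ltgtP (dot w h) 0) wh => // wh _; split; rewrite inE; apply/asboolP;
  [exists u2|exists u1|exists u1|exists u2] => //;
  rewrite realizes_cons ?u1o ?u2o ?E1 ?E2 ?andbT ?dotNl ?pmulr_rlt0 ?pmulr_rgt0 // ?oppr_gt0 ?oppr_lt0.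
Qed.

(** A subspace [L] that is transversal to the flats through a common point [x]
    of [L] and a closed cell meets the open cell: split the way from [x] to a
    point of the open cell into a part in [L] and a part in the flat through
    [x]; the walls through [x] do not see the latter. *)
Lemma transversal_realizable L s o x :
  (forall T, subseq T s -> (L :&: orth_compl T)%VS != 0%VS -> (L + orth_compl T = fullv)%VS) ->
  realizable fullv s o -> x \in L -> x != 0 -> wrealizes s o x -> realizable L s o.
Proof.
move=> LT [c _ co] xL x0 xo.
pose T := [seq h <- s | dot x h == 0].
have xT : x \in orth_compl T by apply/orth_complP => h; rewrite mem_filter => /andP[/eqP].
have LTf : (L + orth_compl T)%VS = fullv.
  apply: LT; first exact: filter_subseq.
  by apply: contraNneq x0 => LT0; rewrite -memv0 -LT0 memv_cap xL.
have : c \in (L + orth_compl T)%VS by rewrite LTf memvf.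
case/memv_addP => l lL [f fT cE].
have [|r r0 Hr] := realizes_perturb (l := l) co xo.
  move=> h hs xh; rewrite cE dotDl; move/orth_complP: fT => ->; first by rewrite addr0.
  by rewrite mem_filter xh eqxx.
exists (x + r *: l); first by rewrite memvD ?memvZ.
by apply: Hr; rewrite r0 lexx.
Qed.

End SignPatterns.

(** * Cells as connected components *)

Lemma continuous_sum (R : realType) (I : Type) (r : seq I) (T : topologicalType)
    (F : I -> T -> R) :
  (forall i, continuous (F i)) -> continuous (fun x => \sum_(i <- r) F i x).
Proof. by move=> cF x; apply: cvg_big => [|i _]; [exact: add_continuous|exact: cF]. Qed.

Lemma continuous_prod (R : realType) (I : Type) (r : seq I) (T : topologicalType)
    (F : I -> T -> R) :
  (forall i, continuous (F i)) -> continuous (fun x => \prod_(i <- r) F i x).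
Proof. by move=> cF x; apply: cvg_big => [|i _]; [exact: mul_continuous|exact: cF]. Qed.

Section Tessellations.
Variables (R : realType) (d : nat).
Implicit Types (v h u : 'rV[R]_d) (s : seq 'rV[R]_d) (o : seq bool).

Lemma dot_continuous h : continuous (fun v : 'rV[R]_d => dot v h).
Proof.
apply: continuous_sum => k v.
by apply: continuousM; [exact: coord_continuous|exact: cst_continuous].
Qed.

Lemma realizes_neq0 s o v : realizes s o v -> {in s, forall h, dot v h != 0}.
Proof.
elim: s o => // g s IH [|b o] //= /andP[vg vs] h.
rewrite inE => /predU1P[->|]; last exact: IH vs h.
by case: b vg => vg; rewrite neq_lt vg ?orbT.
Qed.

Definition cell s o : set 'rV[R]_d := [set v | realizes s o v].

Lemma closed_wrealizes s o : closed [set v | wrealizes s o v].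
Proof.
elim: s o => [|h s IH] [|b o] /=; try by rewrite (_ : [set _ | _] = set0) ?predeqE //; exact: closed0.
  by rewrite (_ : [set _ | _] = setT) ?predeqE //; exact: closedT.
have -> : [set v | wrealizes (h :: s) (b :: o) v] =
    (fun v => dot v h) @^-1` (if b then [set x | 0 <= x] else [set x | x <= 0])
    `&` [set v | wrealizes s o v].
  by apply/predeqP => v; rewrite /wrealizes /=; case: b; split=> /andP.
apply: closedI; last exact: IH.
apply: (closed_comp (fun v _ => @dot_continuous h v)).
by case: b; [exact: closed_ge|exact: closed_le].
Qed.

Lemma closure_cell s o : closure (cell s o) `<=` [set v | wrealizes s o v].
Proof.
move/closure_id: (@closed_wrealizes s o) => ->; apply: closureS => v.
exact: realizes_wrealizes.
Qed.

Lemma closure_cell0 s o : realizable fullv s o -> closure (cell s o) 0.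
Proof.
case=> v _ vo B /= B0.
have : nbhs (0 : R) ((fun t => t *: v) @^-1` B).
  by apply: (@scalel_continuous R _ v 0); rewrite scale0r.
case/nbhs_ballP => e /= e0 He; exists ((e / 2) *: v); split.
  rewrite /cell /= -[_ *: v]addr0 -[X in _ + X](scale0r v).
  by apply: realizes_comb => //; lra.
by apply: He; rewrite /ball /= sub0r normrN gtr0_norm; lra.
Qed.

Lemma cell_inj s o1 o2 v : realizes s o1 v -> wrealizes s o2 v -> o1 = o2.
Proof.
elim: s o1 o2 => [|h s IH] [|b1 o1] [|b2 o2] //= /andP[h1 s1] /andP[h2 s2].
by rewrite (IH _ _ s1 s2); case: b1 b2 h1 h2 => -[] // h1 h2; exfalso; lra.
Qed.

(** Segments stay in the convex cell. *)
Lemma connected_cell s o v : cell s o v ->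
  cell s o `<=` connected_component (cell s o) v.
Proof.
move=> vo u uo; pose g (t : R) : 'rV[R]_d := (1 - t) *: v + t *: u.
have gC : continuous g.
  move=> t; apply: cvgD; last exact: scalel_continuous.
  by apply: cvgZr_tmp; apply: cvgB; [exact: cvg_cst|exact: cvg_id].
exists (g @` `[0, 1]%classic); last first.
  by exists 1 => //=; rewrite ?in_itv /= ?ler01 ?lexx // /g subrr scale0r add0r scale1r.
split.
- by exists 0 => //=; rewrite ?in_itv /= ?ler01 ?lexx // /g subr0 scale0r addr0 scale1r.
- move=> z [t]; rewrite /= in_itv /= => /andP[t0 t1] <-.
  by apply: realizes_comb => //; lra.
- apply: connected_continuous_connected; first exact: segment_connected.
  exact: continuous_subspaceT.
Qed.

(** On a connected subset of [U], a linear form of [s] cannot change sign without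
    vanishing. *)
Lemma component_cell s (U : set 'rV[R]_d) o v :
  (forall u, U u <-> {in s, forall h, dot u h != 0}) -> cell s o v ->
  connected_component U v = cell s o.
Proof.
move=> UE vo; have sub : cell s o `<=` U.
  by move=> u uo; apply/UE/(realizes_neq0 uo).
apply/seteqP; split=> [u uU|u /(connected_cell vo) [B [Bv Bsub Bc] Bu]]; last first.
  by exists B => //; split=> //; apply: subset_trans Bsub sub.
have Uu := connected_component_sub uU; have Uv := sub _ vo.
have vU : connected_component U v v by exact: connected_component_refl.
have sgn h : h \in s -> (0 < dot u h) = (0 < dot v h).
  move=> hs; have cI : is_interval ((fun u => dot u h) @` connected_component U v).
    apply/connected_intervalP/connected_continuous_connected; first exact: component_connected.
    by apply: continuous_subspaceT; exact: dot_continuous.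
  have nz : ~ ((fun u => dot u h) @` connected_component U v) 0.
    by case=> x /connected_component_sub /UE /(_ _ hs) /eqP.
  have iu : ((fun u => dot u h) @` connected_component U v) (dot u h) by exists u.
  have iv : ((fun u => dot u h) @` connected_component U v) (dot v h) by exists v.
  apply/idP/idP => H; rewrite ltNge; apply/negP => H'; apply: nz.
    by apply: (cI _ _ iv iu); rewrite H' ltW.
  by apply: (cI _ _ iu iv); rewrite H' ltW.
move/UE: Uu => {}Uu; clear -vo sgn Uu; rewrite /cell /=.
elim: s o vo sgn Uu => [|h s IH] [|b o] //= /andP[vh vs] sgn Uu.
rewrite IH // ?andbT; first last.
- by move=> g gs; apply: Uu; rewrite inE gs orbT.
- by move=> g gs; apply: sgn; rewrite inE gs orbT.
have := sgn h (mem_head _ _); have := Uu h (mem_head _ _).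
by case: b vh => [->//|vh]; rewrite [in RHS]ltNge (ltW vh) /= neq_lt => /orP[//|->].
Qed.

Definition sign_pattern s v : (size s).-tuple bool := map_tuple (fun h => 0 < dot v h) (in_tuple s).

Lemma sign_patternP s v : {in s, forall h, dot v h != 0} -> realizes s (sign_pattern s v) v.
Proof.
rewrite /= ; elim: s => //= h s IH H; rewrite IH ?andbT.
  have := H h (mem_head _ _); case: ltrP => // le0; rewrite neq_lt => /orP[//|].
  by rewrite ltNge le0.
by move=> g gs; apply: H; rewrite inE gs orbT.
Qed.

Lemma tessellationE (N : set 'rV[R]_d) s : (forall h, N h <-> h \in s) ->
  tessellation N = [set closure (cell s o) | o in [set` cells fullv s]].
Proof.
move=> Ns; rewrite /tessellation; set U := ~` _.
have UE u : U u <-> {in s, forall h, dot u h != 0}.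
  split=> [Uu h /Ns hN|H [h /Ns hs /eqP]]; last by apply/negP/H.
  by apply/negP => /eqP u0; apply: Uu; exists h.
apply/seteqP; split=> C [].
  move=> v Uv <-.
  have vo := sign_patternP (iffLR (UE v) Uv).
  exists (sign_pattern s v); first by apply/cellsP; exists v; rewrite ?memvf.
  by rewrite (component_cell UE vo).
move=> o /cellsP[v _ vo] <-; exists v; last by rewrite (component_cell UE vo).
exact/UE/(realizes_neq0 vo).
Qed.

Lemma closure_cell_inj s (o1 o2 : (size s).-tuple bool) :
  o1 \in cells fullv s -> o2 \in cells fullv s ->
  closure (cell s o1) = closure (cell s o2) -> o1 = o2.
Proof.
move=> /cellsP [v _ vo] _ E; apply/val_inj/(cell_inj vo).
by apply: (@closure_cell _ _); rewrite -E; apply: subset_closure.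
Qed.

Lemma tessellation_sum (N : set 'rV[R]_d) s (phi : set 'rV[R]_d -> R) :
  (forall h, N h <-> h \in s) ->
  #|` fset_set (tessellation N)| = count_cells fullv s /\
  \sum_(C \in tessellation N) phi C = \sum_(o in cells fullv s) phi (closure (cell s o)).
Proof.
move=> /tessellationE ->; set f := fun o : (size s).-tuple bool => closure (cell s o).
have injf : set_inj [set` cells fullv s] f.
  by move=> o1 o2 /set_mem c1 /set_mem c2; apply: closure_cell_inj.
have finC : finite_set [set` cells fullv s] by apply: finite_finset.
split.
  rewrite fset_set_image // card_in_imfset /=; last first.
    by move=> o1 o2; rewrite !in_fset_set // => c1 c2; apply: injf.
  rewrite -card_cells cardE; apply: perm_size; apply: uniq_perm.
  - exact: fset_uniq.
  - exact: enum_uniq.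
  - by move=> o; rewrite in_fset_set // mem_enum mem_setE.
rewrite fsbig_image // -big_enum [RHS]fsbig_seq ?enum_uniq //.
have -> // : [set` enum (cells fullv s)] = [set` cells fullv s].
by apply/seteqP; split=> o /=; rewrite mem_enum.
Qed.

End Tessellations.

(** * The normals of the Weyl tessellations *)

Definition weyl (R : realType) (d n : nat) (b : bool) (y : 'I_n -> 'rV[R]_d) :
    set (set 'rV[R]_d) :=
  if b then weylB y else weylA y.

Section WeylNormals.
Variables (R : realType) (d n : nat) (y : 'I_n -> 'rV[R]_d).
Implicit Types (l : seq 'I_n) (h z : 'rV[R]_d).

Lemma mem_targets b l z : z \in targets b y l <->
  [\/ exists2 j, j \in l & z = y j, b /\ exists2 j, j \in l & z = - y j | b /\ z = 0].
Proof.
elim: l z => [|i l IH] z /=.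
  split=> [|[[j //]|[_ [j //]]|[-> ->]]]; last by rewrite inE.
  by case: b => //; rewrite inE => /eqP ->; apply: Or33.
rewrite inE mem_cat; split=> [/or3P[/eqP ->|zb|/IH [[j jl ->]|[bT [j jl ->]]|[bT ->]]]|].
- by apply: Or31; exists i; rewrite ?mem_head.
- case: b zb {IH} => //; rewrite inE => /eqP ->; apply: Or32; split => //.
  by exists i; rewrite ?mem_head.
- by apply: Or31; exists j; rewrite // inE jl orbT.
- by apply: Or32; split=> //; exists j; rewrite // inE jl orbT.
- exact: Or33.
case=> [[j]|[bT [j]]|[bT ->]].
- rewrite inE => /predU1P[-> ->|jl ->]; first by rewrite eqxx.
  by apply/or3P; apply: Or33; apply/IH; apply: Or31; exists j.
- rewrite inE => /predU1P[-> ->|jl ->]; first by rewrite bT inE eqxx !orbT.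
  by apply/or3P; apply: Or33; apply/IH; apply: Or32; split=> //; exists j.
- by apply/or3P; apply: Or33; apply/IH; apply: Or33.
Qed.

Lemma mem_weyl_normals b l h : pairwise (fun i j : 'I_n => (i < j)%N) l ->
  h \in weyl_normals b y l <->
  [\/ exists2 p : 'I_n * 'I_n, [/\ p.1 \in l, p.2 \in l & (p.1 < p.2)%N] & h = y p.1 - y p.2,
      b /\ exists2 p : 'I_n * 'I_n, [/\ p.1 \in l, p.2 \in l & (p.1 < p.2)%N] & h = y p.1 + y p.2 |
      b /\ exists2 i, i \in l & h = y i].
Proof.
elim: l h => [|i l IH] h; first by split=> // -[[p []]|[_ [p []]]|[_ [i]]].
rewrite pairwise_cons => /andP[/allP il pl]; move: {IH}(fun h => IH h pl) => IH /=.
rewrite mem_cat; split=> [/orP[/mapP[z /mem_targets Hz ->]|/IH]|].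
- case: Hz => [[j jl ->]|[bT [j jl ->]]|[bT ->]].
  + by apply: Or31; exists (i, j); rewrite //= mem_head inE jl orbT il.
  + by apply: Or32; split=> //; exists (i, j); rewrite /= ?opprK // mem_head inE jl orbT il.
  + by apply: Or33; split=> //; exists i; rewrite ?subr0 ?mem_head.
- case=> [[p [p1 p2 lt] ->]|[bT [p [p1 p2 lt] ->]]|[bT [j jl ->]]].
  + by apply: Or31; exists p => //; rewrite !inE p1 p2 !orbT.
  + by apply: Or32; split=> //; exists p => //; rewrite !inE p1 p2 !orbT.
  + by apply: Or33; split=> //; exists j => //; rewrite inE jl orbT.
have key (p : 'I_n * 'I_n) : p.1 \in i :: l -> p.2 \in i :: l -> (p.1 < p.2)%N ->
    (p.1 = i /\ p.2 \in l) \/ (p.1 \in l /\ p.2 \in l).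
  rewrite !inE => /predU1P[->|p1] /predU1P[->|p2]; rewrite ?ltnn //; first by left.
    by move/il: p1 => ? ?; lia.
  by right.
have new z : z \in targets b y l -> y i - z \in [seq y i - z | z <- targets b y l].
  by move=> zl; apply/mapP; exists z.
case=> [[p [p1 p2 lt] ->]|[bT [p [p1 p2 lt] ->]]|[bT [j jl ->]]]; apply/orP.
- case: (key p p1 p2 lt) => [[-> p2l]|[p1l p2l]].
    by left; apply: new; apply/mem_targets; apply: Or31; exists p.2.
  by right; apply/IH; apply: Or31; exists p.
- case: (key p p1 p2 lt) => [[-> p2l]|[p1l p2l]].
    left; have -> : y i + y p.2 = y i - (- y p.2) by rewrite opprK.
    apply: new; apply/mem_targets.
    by apply: Or32; split=> //; exists p.2.
  by right; apply/IH; apply: Or32; split=> //; exists p.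
- move: jl; rewrite inE => /predU1P[->|jl].
    left; apply/mapP; exists 0; last by rewrite subr0.
    by apply/mem_targets; apply: Or33.
  by right; apply/IH; apply: Or33; split=> //; exists j.
Qed.

Lemma weyl_tessellation b : exists2 N, weyl b y = tessellation N &
  forall h, N h <-> h \in weyl_normals b y (enum 'I_n).
Proof.
have srt : pairwise (fun i j : 'I_n => (i < j)%N) (enum 'I_n).
  rewrite -(pairwise_map val ltn) val_enum_ord -sorted_pairwise ?iota_ltn_sorted //.
  exact: ltn_trans.
rewrite /weyl; case: b; [rewrite /weylB|rewrite /weylA]; eexists; try reflexivity.
  move=> h; split=> [|/(mem_weyl_normals _ _ srt)].
    move=> [[[p /= lt <-]|[p /= lt <-]]|[i _ <-]]; apply/(mem_weyl_normals _ _ srt).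
    - by apply: Or32; split=> //; exists p => //; rewrite !mem_enum.
    - by apply: Or31; exists p => //; rewrite !mem_enum.
    - by apply: Or33; split=> //; exists i => //; rewrite !mem_enum.
  case=> [[p [_ _ lt] ->]|[_ [p [_ _ lt] ->]]|[_ [i _ ->]]].
  - by left; right; exists p.
  - by left; left; exists p.
  - by right; exists i.
move=> h; split=> [[p /= lt <-]|/(mem_weyl_normals _ _ srt)].
  by apply/(mem_weyl_normals _ _ srt); apply: Or31; exists p => //; rewrite !mem_enum.
by case=> [[p [_ _ lt] ->]|[]|[]] //; exists p.
Qed.

End WeylNormals.

(** * Open and measurable sets of subspaces *)

(** The lower integral of a nonnegative function that is not assumed to be
    measurable is the supremum of the integrals of the simple functions below it,
    and such simple functions may be cut off on a null set. *)
Lemma ge0_integral_ae_eq (dT : measure_display) (T : measurableType dT) (R : realType)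
    (mu : {measure set T -> \bar R}) (f g : T -> \bar R) :
  (forall x, 0 <= f x)%E -> (forall x, 0 <= g x)%E -> measurable_fun setT g ->
  {ae mu, forall x, f x = g x} -> (\int[mu]_x f x = \int[mu]_x g x)%E.
Proof.
move=> f0 g0 mg fg; apply/eqP; rewrite eq_le; apply/andP; split.
  rewrite [leLHS]ge0_integralTE //; apply: ge_ereal_sup => _ [h /= hf <-].
  have -> : sintegral mu h = (\int[mu]_x (h x)%:E)%E.
    by rewrite integral_nnsfun // patch_setT.
  apply: ae_ge0_le_integral => //.
  - by move=> x _; rewrite lee_fin.
  - exact/measurable_EFinP.
  - by apply: filterS fg => x <- _.
have [N [mN N0 fgN]] := fg.
rewrite (ge0_negligible_integral mN) // ge0_integralE //.
rewrite [leRHS]ge0_integralTE //; apply: ereal_sup_le => _ [h hg <-].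
exists h => // x; apply: le_trans (hg x) _.
rewrite patchE; case: ifPn => // /set_mem [_ xN].
have -> // : g x = f x.
by apply: contrapT => gf; apply: xN; apply: fgN => /= fgx; apply: gf.
Qed.

Section OpenSubspaces.
Variables (R : realType) (d m : nat) (le_md : (m <= d)%N).
Local Notation G := (grass R le_md).
Implicit Types (A : 'M[R]_(m, d)) (X : {vspace 'rV[R]_d}) (v : 'rV[R]_d).

Lemma memv_row_space A v : v \in row_space A -> exists c : 'rV[R]_m, v = c *m A.
Proof. by case/memv_imgP => c _ ->; exists c; rewrite lfunE. Qed.

Lemma mulmx_row_space A (c : 'rV[R]_m) : c *m A \in row_space A.
Proof. by apply/memv_imgP; exists c; rewrite ?memvf // lfunE. Qed.

Lemma mulmx_entry_continuous p (P : 'M[R]_(d, p)) i j :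
  continuous (fun A : 'M[R]_(m, d) => (A *m P) i j).
Proof.
rewrite (_ : (fun _ => _) = (fun A : 'M[R]_(m, d) => \sum_k A i k * P k j)).
  by apply: continuous_sum => k A; apply: continuousM; [exact: coord_continuous|exact: cst_continuous].
by apply/funext => A; rewrite mxE.
Qed.

Lemma det_mulmx_continuous (P : 'M[R]_(d, m)) :
  continuous (fun A : 'M[R]_(m, d) => \det (A *m P)).
Proof.
have cP (s : 'S_m) : continuous (fun A : 'M[R]_(m, d) => \prod_i (A *m P) i (s i)).
  by apply: continuous_prod => i; apply: mulmx_entry_continuous.
have cS (s : 'S_m) :
    continuous (fun A : 'M[R]_(m, d) => (-1) ^+ s * \prod_i (A *m P) i (s i) : R).
  move=> A; have := @continuousM R _ (fun=> (-1) ^+ s) (fun A : 'M[R]_(m, d) =>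
    \prod_i (A *m P) i (s i)) A; apply; [exact: cst_continuous|exact: cP].
exact: continuous_sum cS.
Qed.

Lemma dot_mulmx_continuous (c : 'rV[R]_m) h :
  continuous (fun A : 'M[R]_(m, d) => dot (c *m A) h).
Proof.
apply: continuous_sum => k A; apply: continuousM; last exact: cst_continuous.
rewrite (_ : (fun _ => _) = (fun A : 'M[R]_(m, d) => \sum_i c 0 i * A i k)).
  by apply: continuous_sum => i {}A; apply: continuousM; [exact: cst_continuous|exact: coord_continuous].
by apply/funext => B; rewrite mxE.
Qed.

Lemma frame_open (U : set G) (V : set 'M[R]_(m, d)) : open V ->
  (forall A : @frames R d m, U (span_frame le_md A) <-> V (val A)) -> open U.
Proof.
move=> oV UV; change (open (span_frame le_md @^-1` U)).
have -> : span_frame le_md @^-1` U = (set_val : @frames R d m -> _) @^-1` V.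
  by apply/seteqP; split=> A /= /UV.
by apply: open_comp oV => A _; apply: initial_continuous.
Qed.

Definition meets X : set G := [set L | (val L :&: X)%VS != 0%VS].

Lemma meetsP X (L : G) : meets X L <-> exists2 v, v != 0 & v \in val L /\ v \in X.
Proof.
split=> [LX|[v v0 [vL vX]]]; last first.
  by apply: contraNneq v0 => LX; rewrite -memv0 -LX memv_cap vL.
exists (vpick (val L :&: X)); first by rewrite vpick0.
by apply/andP; rewrite -memv_cap memv_pick.
Qed.

(** With a matrix [Q] whose left kernel is [X], a frame [A] spans a subspace that
    avoids [X] if and only if [A *m Q] has a right inverse [N]; then
    [A' *m Q *m N] stays invertible for [A'] near [A]. *)
Lemma open_meetsC X : open (~` meets X).
Proof.
pose Q := lin1_mx (fun v => v - projv X v).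
have QE v : v *m Q = v - projv X v.
  by rewrite -[RHS](mul_rV_lin1 (idfun \- projv X)).
have Q0 v : (v *m Q == 0) = (v \in X).
  rewrite QE subr_eq0; apply/eqP/idP => [->|/projv_id -> //]; exact: memv_proj.
apply: (@frame_open _ (\bigcup_(N in [set: 'M[R]_(d, m)])
    (fun A => \det (A *m (Q *m N))) @^-1` [set x | x != 0])).
  apply: bigcup_open => N _; apply: open_comp => [A _|]; first exact: det_mulmx_continuous.
  exact: open_neq.
move=> A; have Af : row_free (val A) by have := valP A; rewrite inE.
split=> [nm|[N _ /= dN] /meetsP[v v0 [/memv_row_space[c cv] vX]]]; last first.
  move: vX; rewrite -Q0 cv -mulmxA => /eqP c0.
  have U : val A *m (Q *m N) \in unitmx by rewrite unitmxE unitfE.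
  case/eqP: v0; rewrite cv (_ : c = 0) ?mul0mx //.
  by rewrite -[c](mulmxK U) !mulmxA -[c *m _ *m _]mulmxA c0 !mul0mx.
have /row_freeP[N AN] : row_free (val A *m Q).
  rewrite -kermx_eq0; apply/rowV0P => c /sub_kermxP c0.
  apply/eqP; apply: contrapT => /eqP cn; apply: nm; apply/meetsP; exists (c *m val A).
    by apply: contraNneq cn => /eqP; rewrite mulmx_free_eq0 // => ->.
  by split; [exact: mulmx_row_space|rewrite -Q0 -mulmxA c0].
by exists N => //=; rewrite mulmxA AN det1 oner_neq0.
Qed.

Definition hits (s : seq 'rV[R]_d) (o : seq bool) : set G :=
  [set L | realizable (val L) s o].

Lemma open_hits s o : open (hits s o).
Proof.
apply: (@frame_open _ (\bigcup_(c in [set: 'rV[R]_m]) [set A | realizes s o (c *m A)])).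
  apply: bigcup_open => c _; elim: s o => [|h s IH] [|b o] /=;
    try by rewrite (_ : [set _ | _] = set0) ?predeqE //; exact: open0.
    by rewrite (_ : [set _ | _] = setT) ?predeqE //; exact: openT.
  rewrite (_ : [set A | _] = (fun A => dot (c *m A) h) @^-1`
      (if b then [set x | 0 < x] else [set x | x < 0]) `&` [set A | realizes s o (c *m A)]).
    apply: openI; last exact: IH.
    apply: open_comp => [A _|]; first exact: dot_mulmx_continuous.
    by case: b; [exact: open_gt|exact: open_lt].
  by apply/predeqP => A; rewrite /realizes /=; case: b; split=> /andP.
move=> A; split=> [[v /memv_row_space[c ->] vo]|[c _ co]]; first by exists c.
by exists (c *m val A) => //; exact: mulmx_row_space.
Qed.

Lemma open_measurable (U : set G) : open U -> measurable (U : set (borel G)).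
Proof. by move=> oU; apply: sub_sigma_algebra. Qed.

Lemma measurable_meets X : measurable (meets X : set (borel G)).
Proof.
rewrite -[meets X]setCK; apply: measurableC; apply: open_measurable.
exact: open_meetsC.
Qed.

Lemma measurable_hits s o : measurable (hits s o : set (borel G)).
Proof. by apply: open_measurable; apply: open_hits. Qed.

End OpenSubspaces.

(** * Rotations and the moment curve *)

Section Rotations.
Variables (R : realType) (d : nat).
Implicit Types (a u w x : 'rV[R]_d) (g : 'M[R]_d).

Definition reflection a : 'M[R]_d := 1%:M - (2 / dot a a) *: (a^T *m a).

Lemma mulmx_reflection x a : x *m reflection a = x - (2 * dot x a / dot a a) *: a.
Proof.
rewrite mulmxBr mulmx1 -scalemxAr mulmxA dot_mulmx mul_scalar_mx scalerA.
by rewrite mulrAC.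
Qed.


(** Compare the determinants of the two products of a block matrix with the same
    block triangular matrix. *)
Lemma det_1_sub n (b : 'rV[R]_n) (c : 'cV[R]_n) :
  \det (1%:M - c *m b) = 1 - (b *m c) 0 0.
Proof.
pose M := block_mx (1%:M : 'M[R]_1) b c (1%:M : 'M[R]_n).
have M1 : M *m block_mx 1%:M 0 (- c) 1%:M = block_mx (1%:M - b *m c) b 0 1%:M.
  rewrite mulmx_block !(mulmx1, mul1mx, mulmx0, mul0mx, add0r, addr0) mulmxN.
  by rewrite subrr.
have M2 : block_mx 1%:M 0 (- c) 1%:M *m M = block_mx 1%:M b 0 (1%:M - c *m b).
  rewrite mulmx_block !(mulmx1, mul1mx, mulmx0, mul0mx, add0r, addr0) !mulNmx.
  by rewrite addNr addrC.
have := congr1 determinant M1; have := congr1 determinant M2.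
rewrite !det_mulmx !det_lblock !det_ublock !det1 !(mul1r, mulr1) => <- ->.
by rewrite det_mx11 !mxE eqxx.
Qed.

Lemma det_reflection a : a != 0 -> \det (reflection a) = -1.
Proof.
rewrite -dot_eq0 => a0; rewrite /reflection scalemxAr det_1_sub -scalemxAl dot_mulmx !mxE mulr1n.
by rewrite divfK //; lra.
Qed.

Lemma reflectionK a x : a != 0 -> x *m reflection a *m reflection a = x.
Proof.
rewrite -dot_eq0 => a0; rewrite [in LHS]mulmx_reflection mulmx_reflection.
rewrite dotBl dotZl divfK // -addrA -opprD -scalerDl.
set t := dot x a; have -> : 2 * t / dot a a + 2 * (t - 2 * t) / dot a a = 0 by field.
by rewrite scale0r subr0.
Qed.

(** Any line can be rotated onto any other one by a rotation that fixes the
    vectors orthogonal to both: the reflection that exchanges two vectors of the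
    same length on these lines, corrected by a reflection of the second line. *)
Lemma rotation_line u w : u != 0 -> w != 0 -> exists g,
  [/\ g *m g^T = 1%:M, \det g = 1,
      forall x, dot x u = 0 -> dot x w = 0 -> x *m g = x &
      exists2 c, c != 0 & u *m g = c *: w].
Proof.
move=> u0 w0.
have uu : 0 < dot u u by rewrite lt_neqAle dot_ge0 eq_sym dot_eq0 u0.
have ww : 0 < dot w w by rewrite lt_neqAle dot_ge0 eq_sym dot_eq0 w0.
pose r := Num.sqrt (dot u u / dot w w).
have r0 : 0 < r by rewrite sqrtr_gt0 divr_gt0.
have rr : r * r * dot w w = dot u u by rewrite -expr2 sqr_sqrtr ?divfK ?gt_eqF // ltW // divr_gt0.
pose w' := r *: w; have eqn : dot w' w' = dot u u by rewrite dotZl dotZr mulrA.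
have w'0 : w' != 0 by rewrite -dot_eq0 eqn dot_eq0.
have [uw|nuw] := eqVneq u w'.
  exists 1%:M; rewrite trmx1 mulmx1 det1; split=> // [x _ _|]; first by rewrite mulmx1.
  by exists r; rewrite ?mulmx1 ?gt_eqF.
pose a := u - w'; have a0 : a != 0 by rewrite subr_eq0.
have orth b : b != 0 -> reflection b *m (reflection b)^T = 1%:M.
  move=> b0; have -> : (reflection b)^T = reflection b.
    by rewrite /reflection linearB /= trmx1 linearZ /= trmx_mul trmxK.
  by apply/row_matrixP => i; rewrite row_mul rowE reflectionK // row1.
exists (reflection a *m reflection w'); split.
- by rewrite trmx_mul mulmxA -(mulmxA (reflection a)) orth // mulmx1 orth.
- by rewrite det_mulmx !det_reflection // mulrNN mulr1.
- move=> x xu xw; have xw' : dot x w' = 0 by rewrite dotZr xw mulr0.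
  have xa : dot x a = 0 by rewrite dotBr xu xw' subr0.
  rewrite mulmxA [x *m reflection a]mulmx_reflection xa mulr0 mul0r scale0r subr0.
  by rewrite mulmx_reflection xw' mulr0 mul0r scale0r subr0.
exists (- r); first by rewrite oppr_eq0 gt_eqF.
have -> : u *m (reflection a *m reflection w') = w' *m reflection w'.
  rewrite mulmxA [u *m reflection a]mulmx_reflection.
  have E : 2 * dot u a = dot a a.
    by rewrite [in RHS]dotBl !dotBr eqn (dotC w' u); lra.
  by rewrite E divff ?dot_eq0 // scale1r /a opprB addrC subrK.
by rewrite mulmx_reflection -mulrA divff ?dot_eq0 // mulr1 scaleNr -/w' -[X in X - _]scale1r -scalerBl (_ : 1 - 2 = -1) ?scaleN1r //; lra.
Qed.

End Rotations.

Section MomentCurve.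
Variables (R : realType) (d : nat).

Definition moment (i : nat) : 'rV[R]_d := \row_(k < d) i%:R ^+ k.

(** A proper subspace lies in a hyperplane, on which the points of the moment
    curve are the roots of a polynomial of degree less than [d]. *)
Lemma count_moment (V : {vspace 'rV[R]_d}) M : V != fullv ->
  (count (fun i => moment i \in V) (iota 0 M) <= d)%N.
Proof.
case/orth_vector => h h0 /subvP Vh.
have p0 : rVpoly h != 0 by apply: contra h0 => /eqP p0; rewrite -[h]rVpolyK p0 linear0.
pose s := [seq (i%:R : R) | i <- iota 0 M & moment i \in V].
have -> : count (fun i => moment i \in V) (iota 0 M) = size s.
  by rewrite size_map size_filter.
apply: leq_trans (size_poly _ _ : (size (rVpoly h) <= d)%N); apply: ltnW.
apply: max_poly_roots => //; last first.
  by rewrite map_inj_uniq ?filter_uniq ?iota_uniq // => i j /eqP; rewrite eqr_nat => /eqP.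
apply/allP => x /mapP[i]; rewrite mem_filter => /andP[/Vh iV _] ->.
move: iV; rewrite memv_hyper /root => /eqP <-.
rewrite (@horner_coef_wide _ d) ?size_poly //; apply/eqP; apply: eq_bigr => k _.
by rewrite coef_rVpoly_ord mxE mulrC.
Qed.

End MomentCurve.

(** * Transversality of a random subspace *)

(** Integrate the number of the sets to which a point belongs. *)
Lemma measure_packing (dT : measure_display) (T : measurableType dT) (R : realType)
    (P : probability T R) (r : seq nat) (E : nat -> set T) (k : nat) :
  (forall i, measurable (E i)) ->
  (forall x, (count (fun i => x \in E i) r <= k)%N) ->
  (\sum_(i <- r) P (E i) <= k%:R%:E)%E.
Proof.
move=> mE rk.
have mI i : measurable_fun [set: T] (fun x => (\1_(E i) x)%:E : \bar R).
  by apply/measurable_EFinP; apply: measurable_indic.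
have -> : (\sum_(i <- r) P (E i) = \int[P]_x \sum_(i <- r) (\1_(E i) x)%:E)%E.
  rewrite ge0_integral_sum //.
  by apply: eq_bigr => i _; rewrite integral_indic // setIT.
have -> : (k%:R%:E = \int[P]_(x in [set: T]) (k%:R%:E : \bar R))%E.
  by rewrite integral_cst // [X in (_ * X)%E]probability_setT mule1.
apply: ge0_le_integral => //.
- by move=> x _; apply: sume_ge0 => i _; rewrite lee_fin.
- by apply: emeasurable_sum.
- move=> x _; rewrite sumEFin lee_fin.
  have -> : \sum_(i <- r) \1_(E i) x = (count (fun i => x \in E i) r)%:R :> R.
    by rewrite -sum1_count natr_sum [RHS]big_mkcond /=; apply: eq_bigr => i _; rewrite indicE; case: ifP.
  by rewrite ler_nat.
Qed.

Section Genericity.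
Variables (R : realType) (d m : nat) (le_md : (m <= d)%N).
Local Notation G := (grass R le_md).
Local Notation met := (@meets R d m le_md).
Implicit Types (X : {vspace 'rV[R]_d}) (g : 'M[R]_d).

Definition rotate g X : {vspace 'rV[R]_d} :=
  (linfun (mulmxr g : 'rV[R]_d -> 'rV[R]_d) @: X)%VS.

Lemma memv_rotate g X v : g *m g^T = 1%:M -> (v \in rotate g X) = (v *m g^T \in X).
Proof.
move=> gg; apply/memv_imgP/idP => [[x xX ->]|vX].
  by rewrite lfunE /= -mulmxA gg mulmx1.
by exists (v *m g^T); rewrite // lfunE /= -mulmxA (mulmx1C gg) mulmx1.
Qed.

Lemma dim_rotate g X : g *m g^T = 1%:M -> \dim (rotate g X) = \dim X.
Proof.
move=> gg; apply: limg_dim_eq; apply/eqP; rewrite -subv0; apply/subvP => v.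
rewrite memv_cap memv_ker lfunE /= memv0 => /andP[_ /eqP v0].
by rewrite -[v]mulmx1 -gg mulmxA v0 mul0mx.
Qed.

Lemma dim_grass (L : G) : \dim (val L) = m.
Proof. exact/eqP/(valP L). Qed.

Lemma rotate_set_meets g X : g *m g^T = 1%:M ->
  rotate_set g (met X) = met (rotate g X).
Proof.
move=> gg; have tgg : g^T *m g^T^T = 1%:M by rewrite trmxK (mulmx1C gg).
apply/seteqP; split=> L.
  case=> K /meetsP[v v0 [vK vX]] eL; apply/meetsP; exists (v *m g).
    by apply: contraNneq v0 => v0; rewrite -[v]mulmx1 -gg mulmxA v0 mul0mx.
  by rewrite eL -/(rotate g _) !memv_rotate // -mulmxA gg mulmx1.
move=> /meetsP[v v0 [vL vX]].
have dK : \dim (rotate g^T (val L)) == m by rewrite dim_rotate // dim_grass.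
pose K : G := exist (fun L : {vspace 'rV[R]_d} => \dim L == m) _ dK.
exists K; last first.
  apply/vspaceP => w; rewrite -/(rotate g _) memv_rotate // memv_rotate //.
  by rewrite trmxK -mulmxA (mulmx1C gg) mulmx1.
apply/meetsP; exists (v *m g^T).
  by apply: contraNneq v0 => v0; rewrite -[v]mulmx1 -(mulmx1C gg) mulmxA v0 mul0mx.
by split; [rewrite memv_rotate // trmxK -mulmxA (mulmx1C gg) mulmx1|rewrite -memv_rotate].
Qed.

Variable nu : probability (borel G) R.
Hypothesis nu_inv : rotation_invariant nu.

(** Induction on the dimension of [X], which is the sum of a smaller subspace
    [X'] and a line orthogonal to it. Rotations about [X'] carry [X] to the sums
    of [X'] with the points of the moment curve; all of these have the same
    probability to be met, but a subspace [L] that does not meet [X'] meets at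
    most [d] of them, because it meets such a sum only when the point lies in
    [L + X'], a proper subspace. *)
Lemma meets_null X : (\dim X + m <= d)%N -> nu (met X) = 0%E.
Proof.
have [n] := ubnP (\dim X); elim: n X => // n IH X ltXn dX.
have [->|X0] := eqVneq X 0%VS.
  rewrite (_ : met _ = set0) ?measure0 //; apply/seteqP; split=> // L /meetsP[v v0 [_]].
  by rewrite memv0 (negPf v0).
pose u := vpick X; have u0 : u != 0 by rewrite vpick0.
have uX : u \in X := memv_pick X.
pose X' := (X :&: hyper u)%VS.
have uX' : u \notin X' by rewrite memv_cap memv_hyper dot_eq0 (negPf u0) andbF.
have ltX' : (\dim X' < \dim X)%N.
  rewrite ltnNge; apply: contra uX' => le_dim.
  by have /eqP -> : (X' == X)%VS by rewrite eqEdim capvSl.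
have X'0 : nu (met X') = 0%E by apply: IH; lia.
have mX Z : measurable (met Z : set (borel G)) by apply: measurable_meets.
pose Xi i := (X' + <[moment R d i]>)%VS.
(* Both [X] and [Xi i] are [X'] plus a line orthogonal to [X']; for [Xi i] it is the
   line of the component [w] of the moment vector. *)
have nuX i : moment R d i \notin X' -> nu (met (Xi i)) = nu (met X).
  move=> iX'; have [a aX' Ha] := orth_decomp X' (moment R d i).
  set w := _ - a in Ha.
  have w0 : w != 0 by apply: contra iX'; rewrite subr_eq0 => /eqP ->.
  have [g [gg g1 gfix [c c0 gu]]] := rotation_line u0 w0.
  have gX' x : x \in X' -> x *m g = x.
    move=> xX'; apply: gfix; last by rewrite dotC Ha.
    by move: xX'; rewrite memv_cap memv_hyper => /andP[_ /eqP].
  suff -> : Xi i = rotate g X by rewrite -rotate_set_meets // nu_inv.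
  apply/eqP; rewrite eqEsubv; apply/andP; split; apply/subvP => v.
    case/memv_addP => x xX' [y /vlineP[k ->] ->].
    have -> : x + k *: moment R d i = (x + k *: a + (k / c) *: u) *m g.
      rewrite !mulmxDl -!scalemxAl gu !gX' // scalerA divfK // -addrA -scalerDr.
      by rewrite addrC [a + _]addrC subrK addrC.
    rewrite memv_rotate // -mulmxA gg mulmx1 memvD ?memvZ // memvD ?memvZ //.
      by move: xX'; rewrite memv_cap => /andP[].
    by move: aX'; rewrite memv_cap => /andP[].
  rewrite memv_rotate //; set x := v *m g^T => xX.
  have -> : v = x *m g by rewrite /x -mulmxA (mulmx1C gg) mulmx1.
  pose t := dot x u / dot u u; have xX' : x - t *: u \in X'.
    by rewrite memv_cap memv_hyper memvB ?memvZ //= dotBl dotZl /t divfK ?dot_eq0 // subrr.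
  have -> : x *m g = (x - t *: u - (t * c) *: a) + (t * c) *: moment R d i.
    rewrite -{1}[x](subrK (t *: u)) mulmxDl gX' // -scalemxAl gu scalerA.
    by rewrite -[RHS]addrA scalerBr [- _ + _]addrC.
  apply: memv_add; last by rewrite memvZ ?memv_line.
  by apply: memvB => //; apply: memvZ.
pose r M := [seq i <- iota 0 M | moment R d i \notin X'].
have size_r M : (M <= size (r M) + d)%N.
  have X'f : X' != fullv by apply: contraNneq uX' => ->; apply: memvf.
  have -> : size (r M) = count (predC (fun i => moment R d i \in X')) (iota 0 M).
    by rewrite size_filter.
  rewrite -{1}(size_iota 0 M) -(count_predC (fun i => moment R d i \in X') (iota 0 M)).
  by rewrite addnC leq_add2l count_moment.
pose E i := met (Xi i) `\` met X'.
have mE i : measurable (E i : set (borel G)) by apply: measurableD.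
have pack M : (\sum_(i <- r M) nu (E i) <= d%:R%:E)%E.
  apply: measure_packing => // L.
  have [LX'|LX'] := pselect (met X' L).
    by rewrite (@eq_count _ _ pred0) ?count_pred0 // => i; apply/negbTE; rewrite notin_setE => -[].
  have Vf : (val L + X')%VS != fullv.
    apply/eqP => Lf; have := dimv_add_leqif (val L) X'; rewrite Lf dimvf /dim /= mul1n => -[].
    by rewrite dim_grass; lia.
  apply: leq_trans (count_moment M Vf).
  rewrite /r count_filter; apply: sub_count => i /= /andP[/set_mem [LXi _] _].
  case/meetsP: LXi => v v0 [vL /memv_addP[x xX' [y /vlineP[k ->] ev]]].
  have k0 : k != 0.
    apply: contra_notN LX' => /eqP k0; apply/meetsP; exists v => //; split=> //.
    by rewrite ev k0 scale0r addr0.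
  have -> : moment R d i = k^-1 *: v + (- k^-1) *: x.
    by rewrite ev scalerDr scalerA mulVf // scale1r scaleNr addrC addKr.
  by rewrite memv_add ?memvZ.
have le_nuE i : moment R d i \notin X' -> (nu (met X) <= nu (E i))%E.
  move=> iX'; rewrite -(nuX i iX') -[leRHS]adde0 -X'0.
  apply: le_trans (measureU2 _ _ _) => //; apply: le_measure; rewrite ?inE //.
    exact: measurableU.
  by move=> L LXi; have [?|?] := pselect (met X' L); [right|left].
have fin : nu (met X) \is a fin_num by apply: fin_num_measure.
have key M : M%:R * fine (nu (met X)) <= d%:R + d%:R * fine (nu (met X)).
  have p0 : 0 <= fine (nu (met X)) by apply: fine_ge0.
  have : (size (r M))%:R * fine (nu (met X)) <= d%:R.
    rewrite -lee_fin; apply: le_trans (pack M).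
    have -> : ((size (r M))%:R * fine (nu (met X)))%:E =
        (\sum_(i <- r M) nu (met X))%E.
      rewrite -[in RHS](fineK fin) sumEFin; congr _%:E.
      by rewrite big_const_seq count_predT iter_addr_0 mulr_natl.
    rewrite big_seq [leRHS]big_seq; apply: lee_sum => i.
    by rewrite mem_filter => /andP[iX' _]; apply: le_nuE.
  have : (M%:R : R) <= (size (r M))%:R + d%:R by rewrite -natrD ler_nat.
  nra.
have p0 : 0 <= fine (nu (met X)) by apply: fine_ge0.
rewrite -(fineK fin); congr _%:E; apply/eqP; rewrite eq_le p0 andbT leNgt; apply/negP => pp.
set p := fine _ in key p0 pp.
have := archi_boundP (divr_ge0 (addr_ge0 (ler0n R d) (mulr_ge0 (ler0n R d) p0)) p0).
by rewrite ltr_pdivrMr // ltNge key.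
Qed.

(** The dimension of a transversal intersection. When the dimensions add up to
    more than [d], it is enough that [L] avoids a part of [X] of complementary
    dimension. *)
Lemma ae_transversal_dim X :
  {ae nu, forall L : G, \dim (val L :&: X) = (m + \dim X - d)%N}.
Proof.
have [le|gt] := leqP (m + \dim X) d.
  exists (met X); split; [exact: measurable_meets|by rewrite meets_null // addnC|].
  move=> L /= nd; apply: contrapT => nm; apply: nd.
  have /eqP -> : (val L :&: X == 0)%VS by apply: contrapT => /negP.
  by rewrite dimv0; apply/esym/eqP; rewrite subn_eq0.
pose T := take (d - m) (vbasis X).
have sT : size T = (d - m)%N by rewrite size_takel // size_tuple; lia.
have dT : \dim <<T>> = (d - m)%N.
  rewrite -sT; apply/eqP/(subseq_free (take_subseq _ _)).
  exact: basis_free (vbasisP X).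
have TX : (<<T>> <= X)%VS.
  by apply/span_subvP => x /mem_take; apply: vbasis_mem.
exists (met <<T>>); split; [exact: measurable_meets| |].
  by rewrite meets_null // dT subnK.
move=> L /= nd; apply: contrapT => nm; apply: nd.
have /eqP L0 : (val L :&: <<T>> == 0)%VS by apply: contrapT => /negP.
have Lf : (val L + X)%VS = fullv.
  apply/eqP; rewrite eqEsubv subvf.
  apply: subv_trans (addvS (subvv _) TX).
  have := dimv_sum_cap (val L) <<T>>; rewrite L0 dimv0 addn0 dT dim_grass subnKC // => ds.
  have /eqP -> : (val L + <<T>> == fullv)%VS.
    by rewrite eqEdim subvf ds dimvf /dim /= mul1n.
  exact: subvv.
have := dimv_sum_cap (val L) X; rewrite Lf dimvf /dim /= mul1n dim_grass => <-.
by rewrite addKn.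
Qed.

End Genericity.

(** * The mean over the tessellation *)

Section GenericSections.
Variables (R : realType) (d n : nat) (b : bool) (y : 'I_n -> 'rV[R]_d).
Hypotheses (hd : (2 <= d)%N) (gp : general_position b y).
Local Notation s := (weyl_normals b y (enum 'I_n)).

Lemma enum_points : exists i l, enum 'I_n = i :: l /\ (0 < size (targets b y l))%N.
Proof.
have := general_position_size gp; have := size_enum_ord n.
case: (enum 'I_n) => [|i l] /= sz dn; first by move: dn; case: (b); lia.
exists i, l; split=> //; rewrite size_targets /ntargets.
move: (size l) sz dn => k sz; case: (b); lia.
Qed.

Lemma count_cells_generic m (V : {vspace 'rV[R]_d}) :
  generic_flats b y m V (enum 'I_n) -> count_cells V s = weyl_number b n m.
Proof.
have [i [l [e sz]]] := enum_points; have := size_enum_ord n.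
rewrite e /= => sz_l gV; rewrite (count_cells_weyl sz gV).
by congr (weyl_number b _ m).
Qed.

Lemma weyl_normals_neq0 : exists h, h \in s.
Proof.
have [i [l [-> ]]] := enum_points; case E : (targets b y l) => [|z t] // _.
by exists (y i - z); rewrite /= E mem_head.
Qed.

Variables (m : nat) (le_md : (m <= d)%N) (nu : probability (borel (grass R le_md)) R).
Hypothesis nu_inv : rotation_invariant nu.
Local Notation G := (grass R le_md).

#[local] Instance ae_grass_filter : Filter (nbhs (almost_everywhere nu)).
Proof. exact: ae_filter_ringOfSetsType. Qed.

Lemma ae_all_in (T : eqType) (r : seq T) (P : T -> G -> Prop) :
  (forall x, {ae nu, forall L, P x L}) ->
  {ae nu, forall L, {in r, forall x, P x L}}.
Proof.
move=> aeP; elim: r => [|x r IH]; first exact: aeW.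
apply: filterS2 (aeP x) IH => L Px Pr z; rewrite inE => /predU1P[->|] //.
exact: Pr.
Qed.

Lemma ae_generic_flats : {ae nu, forall L : G, generic_flats b y m (val L) (enum 'I_n)}.
Proof.
have := ae_all_in (flats b y (enum 'I_n)) (fun F => ae_transversal_dim nu_inv (orth_compl F)).
apply: filterS => L HL F Ff; rewrite HL //.
by have := generic_flats_full gp Ff; rewrite capfv => ->; move: le_md; lia.
Qed.

Lemma ae_transversal : {ae nu, forall L : G, forall T, subseq T s ->
  (val L :&: orth_compl T)%VS != 0%VS -> (val L + orth_compl T = fullv)%VS}.
Proof.
have := ae_all_in (enum {: (size s).-tuple bool})
  (fun t => ae_transversal_dim nu_inv (orth_compl (mask (tval t) s))).
apply: filterS => L HL T /subseqP[t /eqP st ->] n0.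
have := HL (Tuple st); rewrite mem_enum => /(_ isT) /= dk.
apply/eqP; rewrite eqEdim subvf dimvf /dim /= mul1n.
have := dimv_sum_cap (val L) (orth_compl (mask t s)); rewrite dk dim_grass.
move: n0; rewrite -dimv_eq0 dk.
by move: (\dim (orth_compl _)) (\dim (_ + _)) => a c; lia.
Qed.

(** The closed cones do not contribute more than the open cells, since a generic
    subspace does not touch a cone at its boundary only. *)
Lemma ae_closed_cell : {ae nu, forall L : G, forall o, realizable fullv s o ->
  (closure (cell s o) `&` [set v | v \in val L] <> [set 0]) <-> hits s o L}.
Proof.
apply: filterS ae_transversal => L LT o o_full; split; last first.
  case=> v vL vo C0; have [h hs] := weyl_normals_neq0.
  have := realizes_neq0 vo hs; have : [set 0 : 'rV[R]_d] v.
    by rewrite -C0; split=> //; apply: subset_closure.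
  by move=> ->; rewrite dot0l eqxx.
move=> Cn0; have [x x0 [xC xL]] : exists2 x, x != 0 &
    closure (cell s o) x /\ x \in val L.
  apply: contrapT => nx; apply: Cn0; apply/seteqP; split=> x.
    move=> [xC xL]; apply: contrapT => /eqP x0; apply: nx; exists x => //.
  by move=> ->; split; [exact: closure_cell0|exact: mem0v].
exact: transversal_realizable LT o_full xL x0 (closure_cell xC).
Qed.

(** Each generic subspace meets as many cells as its own arrangement has. *)
Lemma sum_hits : (\sum_(o in cells fullv s) nu (hits s o) = (weyl_number b n m)%:R%:E)%E.
Proof.
have mI (o : (size s).-tuple bool) :
    measurable_fun [set: borel G] (fun L => (\1_(hits s o : set G) L)%:E : \bar R).
  by apply/measurable_EFinP; apply: measurable_indic; apply: measurable_hits.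
transitivity (\int[nu]_L \sum_(o <- enum (cells fullv s)) (\1_(hits s o : set G) L)%:E)%E.
  rewrite ge0_integral_sum // big_enum; apply: eq_bigr => o _.
  by rewrite integral_indic ?setIT //; apply: measurable_hits.
have -> : ((weyl_number b n m)%:R%:E = \int[nu]_(L in [set: borel G]) ((weyl_number b n m)%:R%:E : \bar R))%E.
  by rewrite integral_cst // [X in (_ * X)%E]probability_setT mule1.
apply: ge0_integral_ae_eq.
- by move=> L; apply: sume_ge0 => o _; rewrite lee_fin.
- by move=> L; rewrite lee_fin.
- exact: measurable_cst.
apply: filterS ae_generic_flats => L gL; rewrite sumEFin; congr _%:E.
rewrite -(count_cells_generic gL) -card_cells -sum1_card natr_sum big_enum /=.
rewrite [LHS]big_mkcond [RHS]big_mkcond; apply: eq_bigr => o _ /=.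
rewrite indicE; case: (boolP (o \in cells (val L) s)) => [/cellsP oL|oL].
  have -> : o \in cells fullv s.
    by case: oL => v _ vo; apply/cellsP; exists v; rewrite ?memvf.
  by rewrite mem_set.
by case: ifP => // _; rewrite memNset // => oL'; case/negP: oL; apply/cellsP.
Qed.

End GenericSections.

Section MeanOverTheTessellation.
Variables (R : realType) (d n j : nat) (b : bool).
Hypothesis hd : (2 <= d)%N.
Variable nu : probability (borel (grass R (leq_subr j d))) R.
Hypothesis nu_inv : rotation_invariant nu.

(** The subspaces that meet the closed cone differ from the open, hence
    measurable, set of the subspaces that meet the cell by a subset of a null
    set. *)
Lemma quermass_cell (y : 'I_n -> 'rV[R]_d) o : general_position b y ->
  realizable fullv (weyl_normals b y (enum 'I_n)) o ->
  quermass nu (closure (cell (weyl_normals b y (enum 'I_n)) o)) =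
  2^-1 * fine (nu (hits (weyl_normals b y (enum 'I_n)) o)).
Proof.
move=> gp o_full; rewrite /quermass /Rintegral; congr (_ * fine _).
rewrite -[X in _ = nu X]setIT -integral_indic //; last exact: measurable_hits.
apply: ge0_integral_ae_eq.
- by move=> L; rewrite lee_fin.
- by move=> L; rewrite lee_fin.
- by apply/measurable_EFinP; apply: measurable_indic; apply: measurable_hits.
have aeF : Filter (nbhs (almost_everywhere nu)) by exact: ae_filter_ringOfSetsType.
have := ae_closed_cell hd gp nu_inv; apply: filterS => L /(_ o o_full) LE.
rewrite !indicE; congr (_%:R%:E); congr (nat_of_bool _).
by apply/idP/idP => /set_mem H; apply/mem_set/LE.
Qed.

Lemma mean_quermass (y : 'I_n -> 'rV[R]_d) : general_position b y ->
  (#|` fset_set (weyl b y)|%:R)^-1 * \sum_(C \in weyl b y) quermass nu C =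
  (weyl_number b n (d - j))%:R / (2 * (weyl_number b n d)%:R).
Proof.
move=> gp; have [N -> NE] := weyl_tessellation y b.
have [-> ->] := tessellation_sum (quermass nu) NE.
rewrite (count_cells_generic hd gp (generic_flats_full gp)).
have -> : \sum_(o in cells fullv (weyl_normals b y (enum 'I_n)))
      quermass nu (closure (cell (weyl_normals b y (enum 'I_n)) o)) =
    2^-1 * (weyl_number b n (d - j))%:R.
  transitivity (\sum_(o in cells fullv (weyl_normals b y (enum 'I_n)))
      2^-1 * fine (nu (hits (weyl_normals b y (enum 'I_n)) o))).
    by apply: eq_bigr => o /cellsP oc; apply: quermass_cell.
  rewrite -mulr_sumr; congr (_ * _); apply: EFin_inj.
  rewrite -(sum_hits hd gp nu_inv) -sumEFin; apply: eq_bigr => o _.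
  by rewrite fineK // fin_num_measure //; apply: measurable_hits.
by rewrite invfM mulrCA mulrA [RHS]mulrC.
Qed.

Lemma weyl_cone_mean (disp : measure_display) (Omega : measurableType disp)
    (P : probability Omega R) (Y : 'I_n -> Omega -> 'rV[R]_d) :
  {ae P, forall w, general_position b (Y^~ w)} ->
  random_cone_mean P (fun w => weyl b (Y^~ w)) (quermass nu) =
  ((weyl_number b n (d - j))%:R / (2 * (weyl_number b n d)%:R))%:E.
Proof.
move=> gpY; rewrite /random_cone_mean unlock.
set c := _ / _.
have -> : (c%:E = \int[P]_(w in [set: Omega]) (c%:E : \bar R))%E.
  by rewrite integral_cst // [X in (_ * X)%E]probability_setT mule1.
apply: ge0_integral_ae_eq.
- move=> w; rewrite lee_fin mulr_ge0 ?invr_ge0 //; apply: sumr_ge0 => C _.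
  by rewrite mulr_ge0 ?invr_ge0 // Rintegral_ge0.
- by move=> w; rewrite lee_fin divr_ge0 // mulr_ge0.
- exact: measurable_cst.
by apply: filterS gpY => w gp; rewrite mean_quermass.
Qed.

End MeanOverTheTessellation.

Theorem corollary1p9 (R : realType) (d : nat) (hd : (2 <= d)%N) :
  (forall (disp : measure_display) (Omega : measurableType disp)
          (P : probability Omega R) (n : nat)
          (Y : 'I_n -> Omega -> 'rV[R]_d),
     (forall i, measurable_fun setT (Y i : Omega -> borel 'rV[R]_d)) ->
     {ae P, forall w, general_positionA (Y^~ w)} ->
     forall (j : nat) (nu : probability (borel (grass R (leq_subr j d))) R),
       (j < d)%N -> rotation_invariant nu ->
       random_cone_mean P (fun w => weylA (Y^~ w)) (quermass nu)
       = ((DA n (d - j))%:R / (2 * (DA n d)%:R))%:E)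
  /\
  (forall (disp : measure_display) (Omega : measurableType disp)
          (P : probability Omega R) (n : nat)
          (Y : 'I_n -> Omega -> 'rV[R]_d),
     (forall i, measurable_fun setT (Y i : Omega -> borel 'rV[R]_d)) ->
     {ae P, forall w, general_positionB (Y^~ w)} ->
     forall (j : nat) (nu : probability (borel (grass R (leq_subr j d))) R),
       (j < d)%N -> rotation_invariant nu ->
       random_cone_mean P (fun w => weylB (Y^~ w)) (quermass nu)
       = ((DB n (d - j))%:R / (2 * (DB n d)%:R))%:E).
Proof.
by split=> disp Omega P n Y _ gpY j nu _ nu_inv;
  [apply: (@weyl_cone_mean R d n j false)|apply: (@weyl_cone_mean R d n j true)].
Qed.
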